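(* Let $(M,g)$ be a tangential hypersurface, with unit normal vector field $N$, of a locally product-like statistical manifold $(\widetilde{M},\widetilde{g},\widetilde{\nabla},F)$. Then for all $X,Y,Z\in\Gamma(TM)$: $$R(X,Y)\varphi Z+g(A^{\ast}_{N}X,\varphi Z)A_{N}Y-g(A^{\ast}_{N}Y,\varphi Z)A_{N}X-\eta^{\ast}(Z)\{(\overline{\nabla}_{X}A)_{N}Y-(\overline{\nabla}_{Y}A)_{N}X\}$$ $$=\varphi(R(X,Y)Z)-g(A^{\ast}_{N}Y,Z)\varphi(A_{N}X)+g(A^{\ast}_{N}X,Z)\varphi(A_{N}Y)+\{g((\overline{\nabla}^{\ast}_{X}A^{\ast})_{N}Y,Z)-g((\overline{\nabla}^{\ast}_{Y}A^{\ast})_{N}X,Z)\}\xi,$$ and $$R^{\ast}(X,Y)\varphi^{\ast}Z+g(A_{N}X,\varphi^{\ast}Z)A^{\ast}_{N}Y-g(A_{N}Y,\varphi^{\ast}Z)A^{\ast}_{N}X-\eta(Z)\{(\overline{\nabla}^{\ast}_{X}A^{\ast})_{N}Y-(\overline{\nabla}^{\ast}_{Y}A^{\ast})_{N}X\}$$ $$=\varphi^{\ast}(R^{\ast}(X,Y)Z)+\{g((\overline{\nabla}_{X}A)_{N}Y,Z)-g((\overline{\nabla}_{Y}A)_{N}X,Z)\}\xi^{\ast}-g(A_{N}Y,Z)\varphi^{\ast}(A^{\ast}_{N}X)+g(A_{N}X,Z)\varphi^{\ast}(A^{\ast}_{N}Y).$$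
   Context: A statistical manifold $(\widetilde{M},\widetilde{g},\widetilde{\nabla})$ is a Riemannian manifold with a torsion-free affine connection $\widetilde{\nabla}$ such that $\widetilde{\nabla}\widetilde{g}$ is totally symmetric. The dual connection $\widetilde{\nabla}^{\ast}$ is defined by $Z\widetilde{g}(X,Y)=\widetilde{g}(X,\widetilde{\nabla}^{\ast}_{Z}Y)+\widetilde{g}(\widetilde{\nabla}_{Z}X,Y)$; it is also torsion-free. A locally product-like statistical manifold $(\widetilde{M},\widetilde{g},\widetilde{\nabla},F)$ is a statistical manifold with a $(1,1)$-tensor field $F$ satisfying $F^{2}=I$ and $\widetilde{\nabla}F=0$, together with the $(1,1)$-tensor field $F^{\ast}$ satisfying $\widetilde{g}(FX,Y)=\widetilde{g}(X,F^{\ast}Y)$. A hypersurface $(M,g)$ (induced metric $g$, unit normal $N$) is tangential if $FN$ and $F^{\ast}N$ are tangent to $M$. Then put $\xi=FN$, $\xi^{\ast}=F^{\ast}N$, and for $X\in\Gamma(TM)$ write $FX=\varphi X+\eta^{\ast}(X)N$, $F^{\ast}X=\varphi^{\ast}X+\eta(X)N$ with $\varphi X,\varphi^{\ast}X$ tangent to $M$ and $\eta,\eta^{\ast}$ $1$-forms on $M$ (so $\eta(X)=g(X,\xi)$, $\eta^{\ast}(X)=g(X,\xi^{\ast})$). The Gauss and Weingarten formulas, for $X,Y\in\Gamma(TM)$, are $$\widetilde{\nabla}_{X}Y=\nabla_{X}Y+g(A^{\ast}_{N}X,Y)N,\quad \widetilde{\nabla}_{X}N=-A_{N}X+\kappa(X)N,$$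 $$\widetilde{\nabla}^{\ast}_{X}Y=\nabla^{\ast}_{X}Y+g(A_{N}X,Y)N,\quad \widetilde{\nabla}^{\ast}_{X}N=-A^{\ast}_{N}X-\kappa(X)N,$$ which define the induced connections $\nabla,\nabla^{\ast}$ on $M$, the shape operators $A_{N},A^{\ast}_{N}$ and the $1$-form $\kappa$ on $M$. $R$ and $R^{\ast}$ are the curvature tensors of $\nabla$ and $\nabla^{\ast}$, with $R(X,Y)Z=\nabla_{X}\nabla_{Y}Z-\nabla_{Y}\nabla_{X}Z-\nabla_{[X,Y]}Z$. Moreover $$(\overline{\nabla}_{X}A)_{N}Y=\nabla_{X}(A_{N}Y)-\kappa(X)A_{N}Y-A_{N}(\nabla_{X}Y),$$ $$(\overline{\nabla}^{\ast}_{X}A^{\ast})_{N}Y=\nabla^{\ast}_{X}(A^{\ast}_{N}Y)+\kappa(X)A^{\ast}_{N}Y-A^{\ast}_{N}(\nabla^{\ast}_{X}Y).$$ *)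

(* Defs.v *)
From HB Require Import structures.
From mathcomp Require Import all_boot all_order all_algebra.
From mathcomp Require Import all_classical all_reals all_analysis.

Set Implicit Arguments.
Unset Strict Implicit.
Unset Printing Implicit Defensive.

Import Order.TTheory GRing.Theory Num.Theory.
Import numFieldNormedType.Exports.

Local Open Scope classical_set_scope.
Local Open Scope ring_scope.

(** * Smooth maps between normed spaces *)

Section Smooth.
Context {R : realType} {V W : normedModType R}.

(* Both notions are meant for an open [U]: the differentials are taken in [V]. *)
Fixpoint Ck (k : nat) (U : set V) (f : V -> W) : Prop :=
  if k is k'.+1 then
    forall x, U x -> differentiable f x /\
      forall v, Ck k' U (fun y => 'd f y v)
  else forall x, U x -> {for x, continuous f}.

Definition smooth_on (U : set V) (f : V -> W) : Prop := forall k, Ck k U f.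

End Smooth.

(** * Smooth manifolds *)

(* [manifold R n] is the type of manifolds of dimension [n.+1], because the
   normed structure on row vectors is only available in positive dimension.
   A tangential hypersurface has positive dimension anyway: [F] is invertible,
   so that [F N] is a nonzero tangent vector. *)

Record chart (R : realType) (n : nat) (T : topologicalType) := Chart {
  cmap :> T -> 'rV[R]_n.+1 ;
  cinv : 'rV[R]_n.+1 -> T ;
  cdom : set T ;
  cdom_open : open cdom ;
  cimg_open : open (cmap @` cdom) ;
  cmapK : forall p, cdom p -> cinv (cmap p) = p ;
  cmap_cts : forall p, cdom p -> {for p, continuous cmap} ;
  cinv_cts : forall x, (cmap @` cdom) x -> {for x, continuous cinv} }.

Record manifold (R : realType) (n : nat) := Manifold {
  carrier :> topologicalType ;
  manifold_hausdorff : hausdorff_space carrier ;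
  manifold_second_countable : @second_countable carrier ;
  atlas : set (chart R n carrier) ;
  chart_at : carrier -> chart R n carrier ;
  chart_at_atlas : forall p, atlas (chart_at p) ;
  chart_at_dom : forall p, cdom (chart_at p) p ;
  atlas_compatible : forall c c', atlas c -> atlas c' ->
    smooth_on (c @` (cdom c `&` cdom c')) (c' \o cinv c) }.

Arguments atlas {R n} m _.
Arguments chart_at {R n} m _.

(* As in Lean's mathlib, the tangent space at [p] is represented by ['rV_n.+1],
   a tangent vector being given by its coordinates in the chart [chart_at M p].
   A vector field (resp. a tensor field) is thus a function on [M] whose value
   at [p] is a vector (resp. a tensor) on ['rV_n.+1], and smoothness has to be
   read off in the charts of the atlas, cf. [smooth_section]. *)

Section Calculus.
Context {R : realType} {n : nat} {M : manifold R n}.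

Definition smooth_fun {W : normedModType R} (U : set M) (h : M -> W) : Prop :=
  forall c, atlas M c -> smooth_on (c @` (cdom c `&` U)) (h \o cinv c).

(* [mderiv h p v] is the derivative [v(h)] of the vector-valued [h]. *)
Definition mderiv {W : normedModType R} (h : M -> W) (p : M)
    (v : 'rV[R]_n.+1) : W :=
  'd (h \o cinv (chart_at M p)) (chart_at M p p) v.

(* the coordinates, in the chart [c], of the vector [v] tangent at [p] *)
Definition coords (c : chart R n M) (p : M) (v : 'rV[R]_n.+1) : 'rV[R]_n.+1 :=
  mderiv c p v.

(* the vector field (smooth on [cdom c]) whose coordinates in [c] are
   constantly [w]; the coordinate frame of [c] is [frame c (delta_mx 0 k)] *)
Definition frame (c : chart R n M) (w : 'rV[R]_n.+1) : M -> 'rV[R]_n.+1 :=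
  fun q => 'd (chart_at M q \o cinv c) (c q) w.

(* The coordinates of [[X, Y]] are [X(Y^k) - Y(X^k)]. *)
Definition lie_bracket (X Y : M -> 'rV[R]_n.+1) : M -> 'rV[R]_n.+1 :=
  fun p => mderiv (fun q => coords (chart_at M p) q (Y q)) p (X p)
         - mderiv (fun q => coords (chart_at M p) q (X q)) p (Y p).

End Calculus.

Section Maps.
Context {R : realType} {m n : nat} {M : manifold R m} {M' : manifold R n}.

Definition smooth_map (f : M -> M') : Prop :=
  continuous f /\
  forall c, atlas M' c -> smooth_fun (f @^-1` cdom c) (c \o f).

(* the differential [df_p : T_p M -> T_{f p} M'] *)
Definition mdiff (f : M -> M') (p : M) (v : 'rV[R]_m.+1) : 'rV[R]_n.+1 :=
  mderiv (chart_at M' (f p) \o f) p v.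

(* [V] is a smooth section of [f^* TM'] over the open set [U]:
   [V p] is a tangent vector at [f p]. *)
Definition smooth_section (f : M -> M') (U : set M) (V : M -> 'rV[R]_n.+1)
    : Prop :=
  forall c, atlas M' c ->
    smooth_fun (U `&` f @^-1` cdom c) (fun q => coords c (f q) (V q)).

End Maps.

Section Tensors.
Context {R : realType} {n : nat} (M : manifold R n).

Definition smooth_vf (U : set M) (X : M -> 'rV[R]_n.+1) : Prop :=
  smooth_section idfun U X.

Record vector_field := VectorField {
  vf_fun :> M -> 'rV[R]_n.+1 ;
  vf_smooth : smooth_vf setT vf_fun }.

Record one_form := OneForm {
  form_fun :> M -> {scalar 'rV[R]_n.+1} ;
  form_smooth : forall U X, open U -> smooth_vf U X ->
    smooth_fun U (fun p => form_fun p (X p)) }.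

(* (1,1)-tensor fields *)
Record endo_field := EndoField {
  endo_fun :> M -> {linear 'rV[R]_n.+1 -> 'rV[R]_n.+1} ;
  endo_smooth : forall U X, open U -> smooth_vf U X ->
    smooth_vf U (fun p => endo_fun p (X p)) }.

Record riemannian_metric := RiemannianMetric {
  metric_fun :> M -> 'rV[R]_n.+1 -> 'rV[R]_n.+1 -> R ;
  metric_linear : forall p u, scalar (metric_fun p u) ;
  metric_sym : forall p u v, metric_fun p u v = metric_fun p v u ;
  metric_pos : forall p u, u != 0 -> 0 < metric_fun p u u ;
  metric_smooth : forall U X Y, open U -> smooth_vf U X -> smooth_vf U Y ->
    smooth_fun U (fun p => metric_fun p (X p) (Y p)) }.

(* [conn_fun p v Y] is the covariant derivative at [p], along the tangent
   vector [v], of a vector field [Y] which is smooth near [p] (and arbitrary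
   elsewhere).  Since connections are local operators, this amounts to an
   operator on global smooth vector fields.  The Leibniz rule applied to
   indicator functions shows that only the germ of [Y] at [p] matters. *)
Record affine_connection := AffineConnection {
  conn_fun :> forall p : M, 'rV[R]_n.+1 -> (M -> 'rV[R]_n.+1) -> 'rV[R]_n.+1 ;
  conn_linear : forall (U : set M) Y p, open U -> U p -> smooth_vf U Y ->
    linear (fun v => conn_fun p v Y) ;
  conn_add : forall (U : set M) Y Z p v, open U -> U p ->
    smooth_vf U Y -> smooth_vf U Z ->
    conn_fun p v (fun q => Y q + Z q) = conn_fun p v Y + conn_fun p v Z ;
  conn_leibniz : forall (U : set M) (h : M -> R) Y p v, open U -> U p ->
    smooth_fun U h -> smooth_vf U Y ->
    conn_fun p v (fun q => h q *: Y q) = mderiv h p v *: Y p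
                                       + h p *: conn_fun p v Y ;
  conn_smooth : forall U X Y, open U -> smooth_vf U X -> smooth_vf U Y ->
    smooth_vf U (fun p => conn_fun p (X p) Y) }.

End Tensors.

Section Geometry.
Context {R : realType} {n : nat} {M : manifold R n}.
Implicit Types (g : riemannian_metric M) (D Ds : affine_connection M).
Implicit Types (F Fs A : endo_field M) (k : one_form M).
Implicit Types X Y Z : M -> 'rV[R]_n.+1.

(* the vector field [D_X Y] *)
Definition cov D X Y : M -> 'rV[R]_n.+1 := fun p => D p (X p) Y.

Definition torsion_free D : Prop :=
  forall (U : set M) X Y p, open U -> U p -> smooth_vf U X -> smooth_vf U Y ->
    cov D X Y p - cov D Y X p = lie_bracket X Y p.

Definition curvature D X Y Z : M -> 'rV[R]_n.+1 := fun p =>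
  cov D X (cov D Y Z) p - cov D Y (cov D X Z) p - cov D (lie_bracket X Y) Z p.

(* [(D_X g)(Y, Z)] *)
Definition cov_metric D g X Y Z : M -> R := fun p =>
  mderiv (fun q => g q (Y q) (Z q)) p (X p)
  - g p (cov D X Y p) (Z p) - g p (Y p) (cov D X Z p).

(* The two transpositions generate the symmetric group on three letters. *)
Definition totally_symmetric_cov_metric D g : Prop :=
  forall (U : set M) X Y Z p, open U -> U p ->
    smooth_vf U X -> smooth_vf U Y -> smooth_vf U Z ->
    cov_metric D g X Y Z p = cov_metric D g Y X Z p /\
    cov_metric D g X Y Z p = cov_metric D g X Z Y p.

Definition statistical g D : Prop :=
  torsion_free D /\ totally_symmetric_cov_metric D g.

(* [Ds] is the dual connection of [D]. *)
Definition dual_connection g D Ds : Prop :=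
  forall (U : set M) X Y Z p, open U -> U p ->
    smooth_vf U X -> smooth_vf U Y -> smooth_vf U Z ->
    mderiv (fun q => g q (X q) (Y q)) p (Z p) =
    g p (X p) (cov Ds Z Y p) + g p (cov D Z X p) (Y p).

Definition parallel D F : Prop :=
  forall (U : set M) X Y p, open U -> U p -> smooth_vf U X -> smooth_vf U Y ->
    cov D X (fun q => F q (Y q)) p = F p (cov D X Y p).

Definition adjoint g F Fs : Prop :=
  forall p u v, g p (F p u) v = g p u (Fs p v).

Record locally_product_like g D F Fs : Prop := LocallyProductLike {
  lpl_statistical : statistical g D ;
  lpl_involution : forall p u, F p (F p u) = u ;
  lpl_parallel : parallel D F ;
  lpl_adjoint : adjoint g F Fs }.

(* the covariant derivatives of the shape operators of a hypersurface,
   twisted by the normal connection form [k] *)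
Definition cov_shape D k A X Y : M -> 'rV[R]_n.+1 := fun p =>
  cov D X (fun q => A q (Y q)) p - k p (X p) *: A p (Y p) - A p (cov D X Y p).

Definition cov_shape_dual Ds k A X Y : M -> 'rV[R]_n.+1 := fun p =>
  cov Ds X (fun q => A q (Y q)) p + k p (X p) *: A p (Y p)
  - A p (cov Ds X Y p).

End Geometry.

(** * Hypersurfaces *)

Section Hypersurface.
Context {R : realType} {n : nat} {M : manifold R n} {Mt : manifold R n.+1}.
Variable f : M -> Mt.
Implicit Types (g : riemannian_metric M) (gt : riemannian_metric Mt).
Implicit Types (Dt : affine_connection Mt) (F Fs : endo_field Mt).
Implicit Types N V : M -> 'rV[R]_n.+2.

(* [f] is an isometric immersion of codimension one with unit normal [N]. *)
Record hypersurface gt g N : Prop := Hypersurface {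
  hyp_smooth : smooth_map f ;
  hyp_immersion : forall p, injective (mdiff f p) ;
  hyp_isometric : forall p u v,
    g p u v = gt (f p) (mdiff f p u) (mdiff f p v) ;
  hyp_normal_smooth : smooth_section f setT N ;
  hyp_normal_orthogonal : forall p u, gt (f p) (N p) (mdiff f p u) = 0 ;
  hyp_normal_unit : forall p, gt (f p) (N p) (N p) = 1 }.

Definition tangent_to (p : M) (w : 'rV[R]_n.+2) : Prop :=
  exists u, mdiff f p u = w.

Definition tangential F Fs N : Prop :=
  forall p, tangent_to p (F (f p) (N p)) /\ tangent_to p (Fs (f p) (N p)).

(* The covariant derivative at [p], along [v], of a section [V] of [f^* TMt]:
   if [V = sum_k V^k (d_k o f)] near [p], with [d_k] the coordinate fields of
   [chart_at Mt (f p)], then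
     [D_v V = sum_k (v(V^k) d_k + V^k(p) D_{df v} d_k)].
   When [V = Y o f] for a field [Y] on [Mt], in particular for any local
   extension [Y] of a field on an embedded [M], this is [D_{df v} Y]. *)
Definition cov_along Dt V (p : M) (v : 'rV[R]_n.+1) : 'rV[R]_n.+2 :=
  let c := chart_at Mt (f p) in
  mderiv (fun q => coords c (f q) (V q)) p v
  + \sum_(k < n.+2) V p 0 k *: Dt (f p) (mdiff f p v) (frame c (delta_mx 0 k)).

(* the vector field [df(Y)] along [f] *)
Definition push (Y : M -> 'rV[R]_n.+1) : M -> 'rV[R]_n.+2 :=
  fun q => mdiff f q (Y q).

Definition gauss_formula g Dt N (D : affine_connection M) (B : endo_field M)
    : Prop :=
  forall (X Y : vector_field M) p,
    cov_along Dt (push Y) p (X p) =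
    mdiff f p (cov D X Y p) + g p (B p (X p)) (Y p) *: N p.

End Hypersurface.

(* Main.v *)
(** The connection of the ambient manifold induces a connection on the sections
of the pullback bundle [f^* TMt] ([cov_along]).  Since [F] is parallel, this
pullback connection commutes with [F], and therefore so does its curvature
[Rb(X, Y)], without any tensoriality argument.  Computing both sides of
[Rb(X, Y) (F Z) = F (Rb(X, Y) Z)] with the Gauss and Weingarten formulas and
[F Z = phi Z + etas(Z) N] and comparing the tangential parts yields the first
identity.  The second one is the first one for the dual structure
[(Dts, Fs, Ds, As, - kappa)], because [Dts] is torsion-free and [Fs] is parallel
with respect to it.  The induced connections are torsion-free by the symmetry of
second derivatives, applied to the coordinate expression of [f]. *)

Require Import Defs.
From HB Require Import structures.
From mathcomp Require Import all_boot all_order all_algebra.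
From mathcomp Require Import all_classical all_reals all_analysis.
From mathcomp Require Import ring lra.
Import Order.TTheory GRing.Theory Num.Theory.
Import numFieldNormedType.Exports.
Local Open Scope classical_set_scope.
Local Open Scope ring_scope.

Set Implicit Arguments.
Unset Strict Implicit.
Unset Printing Implicit Defensive.

(** * Differentials and maps of class C^k *)

(** Two obstacles shape the proof. [f] is only an immersion, so a section along [f] need not be the
    restriction of a field on [Mt], whereas the hypotheses on [Dt], [F] and [gt] concern fields on
    [Mt]. They are carried over by expanding sections in chart frames composed with [f]
    ([section_ind]). On [M], the Gauss and Weingarten formulas and the decomposition of [F] are
    given at values of global smooth fields, and no single tangent vector is ever extended to such a
    field. Every vector fed to these formulas is therefore exhibited as such a value or as a linear
    combination of such values. In particular the bracket is replaced by [cov D X Y - cov D Y X],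
    which makes torsion-freeness of the induced connections a prerequisite of the curvature
    computation. Since only tangential parts are compared, some normal coefficients stay behind
    existential quantifiers. *)

Section Differential.
Context {R : realType} {V W : normedModType R}.

Lemma differentiable_near_eq (f g : V -> W) x :
  (\forall y \near x, f y = g y) -> differentiable f x ->
  differentiable g x /\ 'd g x = 'd f x :> (V -> W).
Proof.
move=> fg df; have fgx : f x = g x := nbhs_singleton fg.
have dg : g \o shift x = cst (g x) + 'd f x +o_ 0 id.
  apply/eqaddoP => e e0.
  have /eqaddoP /(_ e e0) dfe := diff_locally df.
  have fg0 : \forall h \near (0 : V), f (h + x) = g (h + x).
    by move: fg; rewrite (near_shift 0) subr0 /=; apply: filterS => h /=.
  apply: filterS2 fg0 dfe => h E; rewrite !fctE /= -fgx -E; exact.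
have dgE : 'd g x = 'd f x :> (V -> W).
  by apply: diff_unique => //; exact: diff_continuous.
split=> //; apply/diff_locallyP; rewrite dgE; split=> //; exact: diff_continuous.
Qed.

(** No differentiability is assumed: where a differential does not exist, ['d] is the default value
    of the choice operator, the same for both maps. Derivatives can thus be rewritten along equality
    of germs without side conditions. *)
Lemma diff_near_eq (f g : V -> W) x :
  (\forall y \near x, f y = g y) -> 'd f x = 'd g x :> (V -> W).
Proof.
move=> fg; have gf : \forall y \near x, g y = f y by apply: filterS fg.
have [df|ndf] := pselect (differentiable f x).
  by have [] := differentiable_near_eq fg df.
have ndg : ~ differentiable g x by move=> /(differentiable_near_eq gf)[].
have no_diff (h : V -> W) : ~ differentiable h x -> ~ exists df : {linear V -> W},
    continuous df /\ forall y,
    h y = h (lim (nbhs x)) + df (y - lim (nbhs x)) +o_(y \near x) (y - lim (nbhs x)).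
  by move=> ndh ex; apply: ndh; apply/diffP; exact: (getPex ex).
by rewrite /diff !getPN // => L HL; [apply: (no_diff g ndg)|apply: (no_diff f ndf)]; exists L.
Qed.

Lemma is_diff_scale (h : V -> R) (f : V -> W) x :
  differentiable h x -> differentiable f x ->
  is_diff x (fun y => h y *: f y) (fun v => 'd h x v *: f x + h x *: 'd f x v).
Proof.
move=> dh df.
(* Scaling is packaged as a bilinear map on [R * W], so that the Leibniz rule becomes the
   differential of a continuous bilinear map composed with a pair. *)
have bl : bilinear_for
    (GRing.Scale.Law.clone _ _ *:%R _) (GRing.Scale.Law.clone _ _ *:%R _)
    (fun (a : R) (w : W) => a *: w).
  split=> [w|a] b u v /=; first by rewrite scalerDl scalerA.
  by rewrite scalerDr !scalerA mulrC.
pose sM := bilinear_isBilinear.Build R R W W _ _ _ bl.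
pose s : {bilinear R -> W -> W} := HB.pack (fun (a : R) (w : W) => a *: w) sM.
have sc : continuous (fun p : R * W => s p.1 p.2) by move=> p; apply: scale_continuous.
have ds := differentiable_bilin (h x, f x) sc.
have dp := differentiable_pair dh df.
have E : (fun y => h y *: f y) = (fun p => s p.1 p.2) \o (fun y => (h y, f y)) by [].
rewrite E; apply: DiffDef; first exact: differentiable_comp.
rewrite diff_comp // diff_bilin // diff_pair //.
by apply/funext => v /=; rewrite addrC.
Qed.

End Differential.

Lemma diff_comp_at (R : realType) (U V W : normedModType R) (f : U -> V)
    (g : V -> W) x y : f x = y -> differentiable f x -> differentiable g y ->
  differentiable (g \o f) x /\ 'd (g \o f) x = 'd g y \o 'd f x :> (U -> W).
Proof.
by move=> <- df dg; split; [exact: differentiable_comp|exact: diff_comp].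
Qed.

Section Linear.
Context {R : realType} {m : nat} {W : normedModType R}.

Lemma row_linear_sum (L : {linear 'rV[R]_m.+1 -> W}) v :
  L v = \sum_k v 0 k *: L (delta_mx 0 k).
Proof.
by rewrite {1}(row_sum_delta v) linear_sum; apply: eq_bigr => k _; rewrite linearZ.
Qed.

Lemma row_linear_continuous (L : {linear 'rV[R]_m.+1 -> W}) : continuous L.
Proof.
have -> : (L : _ -> _) = \sum_k (fun v : 'rV_m.+1 => v 0 k *: L (delta_mx 0 k)).
  by apply/funext => v; rewrite fct_sumE [LHS]row_linear_sum.
move=> x; apply: differentiable_continuous; apply: differentiable_sum => k.
apply: (@differentiableZl _ _ _ (fun v : 'rV_m.+1 => v 0 k)).
exact: differentiable_coord.
Qed.

End Linear.

(** A named function, so that it can carry a linear structure and be passed to the lemmas on linear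
    maps. *)
Definition row_coord (R : realType) m (k : 'I_m.+1) (v : 'rV[R]_m.+1) : R := v 0 k.

Fact row_coord_is_linear (R : realType) m (k : 'I_m.+1) : scalar (@row_coord R m k).
Proof. by move=> a u v; rewrite /row_coord !mxE. Qed.
HB.instance Definition _ (R : realType) m (k : 'I_m.+1) :=
  GRing.isLinear.Build R 'rV[R]_m.+1 R _ (@row_coord R m k) (@row_coord_is_linear R m k).

Section Ck.
Context {R : realType}.

Lemma Ck_eq (V W : normedModType R) k (U : set V) (f g : V -> W) : open U ->
  (forall x, U x -> f x = g x) -> Ck k U f -> Ck k U g.
Proof.
move=> oU; elim: k f g => [|k IH] f g fg Hf x Ux.
  have nfg : \forall y \near x, f y = g y by apply: filterS (open_nbhs_nbhs (conj oU Ux)).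
  have := Hf x Ux; rewrite /prop_for /continuous_at -(fg x Ux) => H.
  exact: cvg_trans (near_eq_cvg nfg) H.
have nfg y : U y -> \forall z \near y, f z = g z.
  by move=> Uy; apply: filterS (open_nbhs_nbhs (conj oU Uy)).
have [df Hdf] := Hf x Ux.
have [dg _] := differentiable_near_eq (nfg x Ux) df.
split=> // v; apply: (IH _ _ _ (Hdf v)) => y Uy.
by rewrite (diff_near_eq (nfg y Uy)).
Qed.

Lemma Ck_sub (V W : normedModType R) k (U U' : set V) (f : V -> W) :
  U' `<=` U -> Ck k U f -> Ck k U' f.
Proof.
move=> sU; elim: k f => [|k IH] f Hf x Ux; first exact: Hf (sU _ Ux).
by have [df Hdf] := Hf x (sU _ Ux); split=> // v; apply: IH (Hdf v).
Qed.

Lemma CkW (V W : normedModType R) k (U : set V) (f : V -> W) :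
  Ck k.+1 U f -> Ck k U f.
Proof.
elim: k f => [|k IH] f Hf x Ux; have [df Hdf] := Hf x Ux.
  exact: differentiable_continuous.
by split=> // v; apply: IH (Hdf v).
Qed.

Lemma Ck_cst (V W : normedModType R) k (U : set V) (a : W) : Ck k U (cst a : V -> W).
Proof.
elim: k a => [|k IH] a x Ux; first exact: cst_continuous.
split; first exact: differentiable_cst.
move=> v; have -> : (fun y => 'd (cst a : V -> W) y v) = cst 0.
  by apply/funext => y; rewrite diff_cst.
exact: IH.
Qed.

Lemma Ck_add (V W : normedModType R) k (U : set V) (f g : V -> W) : open U ->
  Ck k U f -> Ck k U g -> Ck k U (fun x => f x + g x).
Proof.
move=> oU; elim: k f g => [|k IH] f g Hf Hg x Ux.
  by apply: continuousD; [exact: Hf|exact: Hg].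
have [df Hdf] := Hf x Ux; have [dg Hdg] := Hg x Ux.
split; first exact: differentiableD.
move=> v; apply: (Ck_eq oU _ (IH _ _ (Hdf v) (Hdg v))) => y Uy.
exact (esym (f_equal (fun L => L v) (diffD (proj1 (Hf y Uy)) (proj1 (Hg y Uy))))).
Qed.

Lemma Ck_sum (V W : normedModType R) I (r : seq I) k (U : set V) (f : I -> V -> W) :
  open U -> (forall i, Ck k U (f i)) -> Ck k U (fun x => \sum_(i <- r) f i x).
Proof.
move=> oU Hf; elim: r => [|i r IH].
  by apply: (Ck_eq oU _ (Ck_cst k U 0)) => x _; rewrite big_nil.
by apply: (Ck_eq oU _ (Ck_add oU (Hf i) IH)) => x _; rewrite big_cons.
Qed.

Lemma Ck_scale (V W : normedModType R) k (U : set V) (h : V -> R) (f : V -> W) :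
  open U -> Ck k U h -> Ck k U f -> Ck k U (fun x => h x *: f x).
Proof.
move=> oU; elim: k h f => [|k IH] h f Hh Hf x Ux.
  by apply: continuousZ; [exact: Hh|exact: Hf].
have [dh Hdh] := Hh x Ux; have [df Hdf] := Hf x Ux.
split; first by have [] := is_diff_scale dh df.
move=> v.
have H1 : Ck k U (fun x => 'd h x v *: f x) by apply: IH; [exact: Hdh|exact: CkW Hf].
have H2 : Ck k U (fun x => h x *: 'd f x v) by apply: IH; [exact: CkW Hh|exact: Hdf].
apply: (Ck_eq oU _ (Ck_add oU H1 H2)) => y Uy.
by have [_ ->] := is_diff_scale (proj1 (Hh y Uy)) (proj1 (Hf y Uy)).
Qed.

Lemma Ck_linear (V : normedModType R) m (W : normedModType R) k (U : set V)
    (L : {linear 'rV[R]_m.+1 -> W}) (f : V -> 'rV[R]_m.+1) : open U ->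
  Ck k U f -> Ck k U (fun x => L (f x)).
Proof.
move=> oU; elim: k f => [|k IH] f Hf x Ux.
  by apply: continuous_comp; [exact: Hf|exact: row_linear_continuous].
have dL y : differentiable L y by apply: linear_differentiable; exact: row_linear_continuous.
have [df Hdf] := Hf x Ux.
split; first exact: differentiable_comp.
move=> v; apply: (Ck_eq oU _ (IH _ (Hdf v))) => y Uy.
have -> := diff_comp (proj1 (Hf y Uy)) (dL (f y)).
by rewrite /= diff_lin //; exact: row_linear_continuous.
Qed.

(** In the chain rule the direction ['d f y v] moves with [y], while [Ck] controls differentials in
    a fixed direction. Expanding that direction in the standard basis leaves fixed directions with
    [C^k] coefficients, which is why the middle space is a space of rows. *)
Lemma Ck_comp (V : normedModType R) m (W : normedModType R) k (U : set V)
    (U' : set 'rV[R]_m.+1) (f : V -> 'rV[R]_m.+1) (g : 'rV[R]_m.+1 -> W) :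
  open U -> (forall x, U x -> U' (f x)) ->
  Ck k U f -> Ck k U' g -> Ck k U (g \o f).
Proof.
move=> oU fU; elim: k g => [|k IH] g Hf Hg x Ux.
  by apply: continuous_comp; [exact: Hf|exact: Hg _ (fU _ Ux)].
have [df Hdf] := Hf x Ux; have [dg Hdg] := Hg _ (fU _ Ux).
split; first exact: differentiable_comp.
move=> v.
have H j : Ck k U (fun y => row_coord j ('d f y v) *: 'd g (f y) (delta_mx 0 j)).
  apply: Ck_scale => //.
    exact: (Ck_linear (row_coord j) oU (Hdf v)).
  apply: (IH (fun z => 'd g z (delta_mx 0 j))); [exact: CkW Hf|exact: Hdg].
apply: (Ck_eq oU _ (Ck_sum _ oU H)) => y Uy.
have -> := diff_comp (proj1 (Hf y Uy)) (proj1 (Hg _ (fU _ Uy))).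
by rewrite /= [RHS]row_linear_sum.
Qed.

End Ck.

Section SmoothOn.
Context {R : realType}.

Lemma smooth_on_diff (V W : normedModType R) (U : set V) (f : V -> W) x :
  smooth_on U f -> U x -> differentiable f x.
Proof. by move=> /(_ 1%N) H Ux; have [] := H x Ux. Qed.

Lemma smooth_on_differential (V W : normedModType R) (U : set V) (f : V -> W) v :
  smooth_on U f -> smooth_on U (fun x => 'd f x v).
Proof.
move=> H k; have Hk := H k.+1; elim: k {H} f Hk => [|k IH] f Hk x Ux.
  by have [_ /(_ v)] := Hk x Ux; apply.
by have [_ /(_ v)] := Hk x Ux; apply.
Qed.

End SmoothOn.

(** * Symmetry of second derivatives *)

Section Schwarz.
Context {R : realType} {V : normedModType R}.

Lemma is_derive_line (h : V -> R) (w u : V) (s : R) :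
  differentiable h (s *: u + w) ->
  is_derive s 1 (fun r : R => h (r *: u + w)) ('d h (s *: u + w) u).
Proof.
move=> dh.
have da : is_diff s (fun r : R => r *: u + w) (fun r : R => r *: u).
  have -> : (fun r : R => r *: u + w) = ( *:%R^~ u : R -> V) + cst w by [].
  by apply: is_diff_eq; rewrite addr0.
have [dA EA] := da.
have E : (fun r : R => h (r *: u + w)) = h \o (fun r : R => r *: u + w) by [].
have dc : differentiable (fun r : R => h (r *: u + w)) s by rewrite E; exact: differentiable_comp.
apply: DeriveDef; first exact: diff_derivable.
by rewrite deriveE // E diff_comp //= EA scale1r.
Qed.

(* The mean value theorem applied to [s |-> h (x + s u + t v) - h (x + s u)]
   compares the second difference with the increment of ['d h _ u] along [t v]. *)
Lemma second_difference (h : V -> R) (x u v : V) (e : R) : 0 < e ->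
  (\forall y \near x, differentiable h y) ->
  differentiable (fun y => 'd h y u) x ->
  \forall t \near 0^'+, `|h (t *: u + (t *: v + x)) - h (t *: u + x)
    - h (t *: v + x) + h x - t ^+ 2 * 'd (fun y => 'd h y u) x v| <= e * t ^+ 2.
Proof.
move=> e0 dh dD; set h1 := fun y => 'd h y u; set L := 'd h1 x.
(* For [0 <= s <= t], the vectors [s u + t v] and [s u] have norm at most [t a]; the summand 1 makes
   [a] positive. Each of the two expansions used below then has error at most
   [e / (2 a) * (t a) = e t / 2]. *)
pose a := `|u| + `|v| + 1.
have a0 : 0 < a by rewrite /a ltr_wpDl // addr_ge0.
have e'0 : 0 < e / (2 * a) by rewrite divr_gt0 // mulr_gt0.
have /eqaddoP /(_ _ e'0) H1 := diff_locally dD.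
have H2 : \forall w \near (0 : V), differentiable h (w + x).
  by move: dh; rewrite (near_shift 0) subr0.
have H12 : nbhs (0 : V) (fun w => `|(h1 \o shift x - (cst (h1 x) + L)) w|
    <= e / (2 * a) * `|w| /\ differentiable h (w + x)) by exact: filterI H1 H2.
have /nbhs_ballP[d /= d0 Hd] := H12.
have {}Hd w : `|w| < d -> differentiable h (w + x) /\
    `|'d h (w + x) u - 'd h x u - L w| <= e / (2 * a) * `|w|.
  move=> wd; have [|A2 A1] := Hd w; first by rewrite -ball_normE /= sub0r normrN.
  by split=> //; move: A2; rewrite !fctE /= opprD addrA.
near=> t.
have t0 : 0 < t by near: t; exact: nbhs_right_gt.
have td : t * a < d.
  rewrite -ltr_pdivlMr //; near: t; apply: nbhs_right_lt; exact: divr_gt0.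
have small s : 0 <= s -> s <= t -> `|s *: u + t *: v| < d /\ `|s *: u| < d
    /\ `|s *: u + t *: v| <= t * a /\ `|s *: u| <= t * a.
  move=> s0 st.
  have B1 : `|s *: u| <= t * `|u| by rewrite normrZ ger0_norm // ler_wpM2r.
  have B2 : `|t *: v| <= t * `|v| by rewrite normrZ gtr0_norm.
  have B3 : `|s *: u + t *: v| <= t * a.
    apply: le_trans (ler_normD _ _) _; rewrite /a !mulrDr mulr1; lra.
  have B4 : `|s *: u| <= t * a.
    have : 0 <= t * `|v| by rewrite mulr_ge0 // ltW.
    rewrite /a !mulrDr mulr1; lra.
  by split; [|split; [|split]] => //; apply: le_lt_trans td.
pose phi s := h (s *: u + (t *: v + x)) - h (s *: u + x).
pose dphi s := 'd h (s *: u + (t *: v + x)) u - 'd h (s *: u + x) u.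
have dphiP s : 0 <= s -> s <= t -> is_derive s 1 phi (dphi s).
  move=> s0 st; have [S1 [S2 _]] := small s s0 st.
  apply: is_deriveB; apply: is_derive_line; last by have [] := Hd _ S2.
  by rewrite addrA; have [] := Hd _ S1.
have [||c cI] := @MVT R phi dphi 0 t t0.
- by move=> s; rewrite in_itv /= => /andP[/ltW s0 /ltW st]; exact: dphiP.
- apply: derivable_within_continuous => s; rewrite in_itv /= => /andP[s0 st].
  by have [] := dphiP s s0 st.
have [c0 ct] : 0 <= c /\ c <= t.
  by move: cI; rewrite in_itv /= => /andP[/ltW ? /ltW ?].
rewrite subr0 {1}/phi /phi scale0r !add0r => E.
have -> : h (t *: u + (t *: v + x)) - h (t *: u + x) - h (t *: v + x) + h x
    = dphi c * t by rewrite -E; ring.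
have [S1 [S2 [S3 S4]]] := small c c0 ct.
have [_ P1] := Hd _ S1; have [_ P2] := Hd _ S2.
have L1 : L (c *: u + t *: v) = L (c *: u) + t * L v by rewrite linearD [X in _ + X]linearZ.
(* Both values of ['d h _ u] are expanded at [x]: the terms ['d h x u] and [L (c u)] cancel, so the
   unknown point [c] of the mean value theorem disappears. *)
have bd : `|dphi c - t * L v| <= e * t.
  have -> : dphi c - t * L v =
    ('d h (c *: u + t *: v + x) u - 'd h x u - L (c *: u + t *: v))
    - ('d h (c *: u + x) u - 'd h x u - L (c *: u)).
    by rewrite L1 /dphi addrA; ring.
  apply: le_trans (ler_normB _ _) _.
  apply: le_trans (lerD P1 P2) _.
  have Q (r : R) : r <= t * a -> e / (2 * a) * r <= e * t / 2.
    move=> /(ler_wpM2l (ltW e'0)) /le_trans; apply.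
    by rewrite le_eqVlt; apply/orP; left; apply/eqP; field; rewrite gt_eqF.
  by have := Q _ S3; have := Q _ S4; lra.
have -> : dphi c * t - t ^+ 2 * L v = t * (dphi c - t * L v) by ring.
rewrite normrM gtr0_norm // expr2 mulrA mulrC.
by rewrite ler_pM2r.
Unshelve. all: by end_near. Qed.

(** The second difference is symmetric in [u] and [v], and both iterated differentials, multiplied
    by [t ^+ 2], approximate it within [e / 2 * t ^+ 2]. A single small positive [t] then bounds
    their distance by [e]. *)
Lemma diff_diff_sym (h : V -> R) (x u v : V) :
  (\forall y \near x, differentiable h y) ->
  differentiable (fun y => 'd h y u) x -> differentiable (fun y => 'd h y v) x ->
  'd (fun y => 'd h y u) x v = 'd (fun y => 'd h y v) x u.
Proof.
move=> dh du dv; set a := LHS; set b := RHS.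
apply/eqP; rewrite -subr_eq0 -normr_le0; apply/ler_addgt0Pr => e e0.
have e20 : 0 < e / 2 by rewrite divr_gt0.
have H1 := second_difference v e20 dh du.
have H2 := second_difference u e20 dh dv.
have [t [K1 [K2 t0]]] := filter_ex (filterI H1 (filterI H2 (nbhs_right_gt 0))).
move: K1 K2; rewrite -/a -/b [t *: v + (t *: u + x)]addrCA.
set d := h (_ + (_ + _)); rewrite [d - h (t *: v + x) - _]addrAC => K1 K2.
have t20 : 0 < t ^+ 2 by rewrite exprn_gt0.
rewrite add0r -(ler_pM2r t20) -{1}(gtr0_norm t20) -normrM.
have -> : (a - b) * t ^+ 2 =
  (d - h (t *: u + x) - h (t *: v + x) + h x - t ^+ 2 * b) -
  (d - h (t *: u + x) - h (t *: v + x) + h x - t ^+ 2 * a) by ring.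
apply: le_trans (ler_normB _ _) _.
by apply: le_trans (lerD K2 K1) _; rewrite -mulrDl -splitr.
Qed.

End Schwarz.

(** * Charts, derivations and smooth fields *)

Section Charts.
Context {R : realType} {n : nat} {M : manifold R n}.
Implicit Types (c : chart R n M) (p q : M).

Lemma near_chart c (S : M -> Prop) p : cdom c p -> (\forall q \near p, S q) ->
  \forall y \near c p, S (cinv c y).
Proof.
move=> cp Sp; have : {for c p, continuous (cinv c)} by apply: cinv_cts; exists p.
by apply; rewrite cmapK.
Qed.

Lemma near_cdom c p : cdom c p -> \forall q \near p, cdom c q.
Proof. by move=> cp; apply: open_nbhs_nbhs; split=> //; exact: cdom_open. Qed.

Lemma near_cimg c p : cdom c p -> \forall y \near c p, (c @` cdom c) y.
Proof. by move=> cp; apply: open_nbhs_nbhs; split; [exact: cimg_open|exists p]. Qed.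

Lemma cinvK c y : (c @` cdom c) y -> c (cinv c y) = y.
Proof. by case=> q cq <-; rewrite cmapK. Qed.

Lemma open_chart_image c (U : set M) : open U -> open (c @` (cdom c `&` U)).
Proof.
move=> oU; rewrite openE => _ [p [cp Up] <-].
have nU : \forall q \near p, U q by exact: open_nbhs_nbhs.
apply: filterS2 (near_cimg cp) (near_chart cp nU) => _ [q cq <-] Uq.
by exists q => //; split=> //; rewrite -(cmapK cq).
Qed.

Lemma differentiable_transition c c' p : atlas M c -> atlas M c' ->
  cdom c p -> cdom c' p -> differentiable (c' \o cinv c) (c p).
Proof.
by move=> ac ac' cp cp'; apply: smooth_on_diff (atlas_compatible ac ac') _; exists p.
Qed.

(** Chain rule through the transition map, which reproduces [h \o cinv c'] only near [c' p]; hence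
    the passage through germs. *)
Lemma diff_change_chart (W : normedModType R) (h : M -> W) c c' p :
  atlas M c -> atlas M c' -> cdom c p -> cdom c' p ->
  differentiable (h \o cinv c) (c p) ->
  differentiable (h \o cinv c') (c' p) /\
  forall v, 'd (h \o cinv c') (c' p) v
    = 'd (h \o cinv c) (c p) ('d (c \o cinv c') (c' p) v).
Proof.
move=> ac ac' cp cp' dh.
have dt := differentiable_transition ac' ac cp' cp.
have E : (c \o cinv c') (c' p) = c p by rewrite /= cmapK.
have near_E : \forall y \near c' p,
    ((h \o cinv c) \o (c \o cinv c')) y = (h \o cinv c') y.
  by apply: filterS (near_chart cp' (near_cdom cp)) => y cy /=; rewrite cmapK.
have [dk kE] := diff_comp_at E dt dh.
have [d1 d2] := differentiable_near_eq near_E dk.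
by split; [exact: d1|move=> v; exact (f_equal (fun L => L v) (etrans d2 kE))].
Qed.

Lemma diff_transition_comp c c' c'' p v : atlas M c -> atlas M c' -> atlas M c'' ->
  cdom c p -> cdom c' p -> cdom c'' p ->
  'd (c'' \o cinv c) (c p) ('d (c \o cinv c') (c' p) v) = 'd (c'' \o cinv c') (c' p) v.
Proof.
move=> ac ac' ac'' cp cp' cp''.
have [_ H] := diff_change_chart ac ac' cp cp' (differentiable_transition ac ac'' cp cp'').
exact: esym (H v).
Qed.

Lemma diff_transition_id c p v : cdom c p -> 'd (c \o cinv c) (c p) v = v.
Proof.
move=> cp; have E : \forall y \near c p, (c \o cinv c) y = id y.
  by apply: filterS (near_cimg cp) => y /cinvK.
by rewrite (diff_near_eq E) diff_val.
Qed.

Lemma coords_linear c p : linear (coords c p).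
Proof. by move=> a u v; rewrite /coords /mderiv linearP. Qed.
HB.instance Definition _ c p := GRing.isLinear.Build R 'rV[R]_n.+1 'rV[R]_n.+1 _
  (coords c p) (coords_linear c p).

Lemma coords_chart_at p v : coords (chart_at M p) p v = v.
Proof. by rewrite /coords /mderiv diff_transition_id //; exact: chart_at_dom. Qed.

Lemma coords_frame c c' w p : atlas M c -> atlas M c' -> cdom c p -> cdom c' p ->
  coords c' p (frame c w p) = 'd (c' \o cinv c) (c p) w.
Proof.
move=> ac ac' cp cp'; apply: diff_transition_comp => //; first exact: chart_at_atlas.
exact: chart_at_dom.
Qed.

Lemma frame_coords c p v : atlas M c -> cdom c p -> frame c (coords c p v) p = v.
Proof.
move=> ac cp; rewrite /frame /coords /mderiv diff_transition_comp //; last 3 first.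
- exact: chart_at_atlas.
- exact: chart_at_dom.
- exact: chart_at_dom.
- by rewrite diff_transition_id //; exact: chart_at_dom.
- exact: chart_at_atlas.
Qed.

Lemma frame_chart_at p w : frame (chart_at M p) w p = w.
Proof. by rewrite -{1}[w](coords_chart_at p) frame_coords //; [exact: chart_at_atlas|exact: chart_at_dom]. Qed.

Lemma frame_expansion c p v : atlas M c -> cdom c p ->
  v = \sum_k coords c p v 0 k *: frame c (delta_mx 0 k) p.
Proof. by move=> ac cp; rewrite -{1}(frame_coords v ac cp) /frame row_linear_sum. Qed.

End Charts.

Section Mderiv.
Context {R : realType} {n : nat} {M : manifold R n}.
Implicit Types (p : M).

Definition mdifferentiable {W : normedModType R} (h : M -> W) p : Prop :=
  differentiable (h \o cinv (chart_at M p)) (chart_at M p p).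

Lemma mderiv_chart (W : normedModType R) (h : M -> W) c p v :
  atlas M c -> cdom c p -> differentiable (h \o cinv c) (c p) ->
  mdifferentiable h p /\ mderiv h p v = 'd (h \o cinv c) (c p) (coords c p v).
Proof.
move=> ac cp dh.
have [d1 d2] := diff_change_chart ac (chart_at_atlas p) cp (chart_at_dom p) dh.
by split; [exact: d1|exact: d2].
Qed.

Lemma smooth_fun_diff_chart (W : normedModType R) (U : set M) (h : M -> W) c p :
  smooth_fun U h -> atlas M c -> cdom c p -> U p ->
  differentiable (h \o cinv c) (c p).
Proof. by move=> sh ac cp Up; apply: smooth_on_diff (sh c ac) _; exists p. Qed.

Lemma smooth_fun_mdifferentiable (W : normedModType R) (U : set M) (h : M -> W) p :
  smooth_fun U h -> U p -> mdifferentiable h p.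
Proof.
move=> sh Up; apply: smooth_fun_diff_chart sh _ _ Up; first exact: chart_at_atlas.
exact: chart_at_dom.
Qed.

Section Rules.
Context {W : normedModType R}.
Implicit Types (h k : M -> W).

Lemma mdifferentiable_near h k p : (\forall q \near p, h q = k q) ->
  mdifferentiable h p -> mdifferentiable k p.
Proof.
move=> hk; have := near_chart (chart_at_dom p) hk => hk'.
by move=> /(differentiable_near_eq hk')[].
Qed.

Lemma mderiv_near h k p v : (\forall q \near p, h q = k q) ->
  mderiv h p v = mderiv k p v.
Proof.
move=> hk; have := near_chart (chart_at_dom p) hk => hk'.
by rewrite /mderiv (diff_near_eq hk').
Qed.

Lemma mderiv_cst (a : W) p v : mderiv (fun _ => a) p v = 0.
Proof. by rewrite /mderiv (_ : _ \o _ = cst a) // diff_cst. Qed.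

Lemma mdifferentiableD h k p : mdifferentiable h p -> mdifferentiable k p ->
  mdifferentiable (fun q => h q + k q) p.
Proof. exact: differentiableD. Qed.

Lemma mderivD h k p v : mdifferentiable h p -> mdifferentiable k p ->
  mderiv (fun q => h q + k q) p v = mderiv h p v + mderiv k p v.
Proof. by move=> dh dk; exact (f_equal (fun L => L v) (diffD dh dk)). Qed.

Lemma mderiv_scale (s : M -> R) h p v : mdifferentiable s p -> mdifferentiable h p ->
  mdifferentiable (fun q => s q *: h q) p /\
  mderiv (fun q => s q *: h q) p v = mderiv s p v *: h p + s p *: mderiv h p v.
Proof.
move=> ds dh; have [d1 d2] := is_diff_scale ds dh; split=> //.
by rewrite /mderiv d2 /= cmapK //; exact: chart_at_dom.
Qed.

Lemma mderiv_linear m (L : {linear 'rV[R]_m.+1 -> W}) (h : M -> 'rV[R]_m.+1) p v :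
  mdifferentiable h p -> mdifferentiable (fun q => L (h q)) p /\
  mderiv (fun q => L (h q)) p v = L (mderiv h p v).
Proof.
move=> dh; have dL y : differentiable L y.
  by apply: linear_differentiable; exact: row_linear_continuous.
split; first exact: (differentiable_comp dh (dL _)).
apply: etrans (f_equal (fun L => L v) (diff_comp dh (dL _))) _.
by rewrite /= diff_lin //; exact: row_linear_continuous.
Qed.

End Rules.
End Mderiv.

Section SmoothFun.
Context {R : realType} {n : nat} {M : manifold R n}.
Implicit Types (U : set M) (X Y : M -> 'rV[R]_n.+1) (c : chart R n M).

Lemma smooth_fun_eq (W : normedModType R) U (h k : M -> W) : open U ->
  (forall q, U q -> h q = k q) -> smooth_fun U h -> smooth_fun U k.
Proof.
move=> oU hk sh c ac m; apply: Ck_eq (sh c ac m); first exact: open_chart_image.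
by move=> _ [q [cq Uq] <-] /=; rewrite cmapK // hk.
Qed.

Lemma smooth_fun_sub (W : normedModType R) U U' (h : M -> W) :
  U' `<=` U -> smooth_fun U h -> smooth_fun U' h.
Proof.
move=> sU sh c ac m; apply: Ck_sub (sh c ac m).
by apply: image_subset; apply: setIS.
Qed.

Lemma smooth_fun_cst (W : normedModType R) U (a : W) : smooth_fun U (fun _ : M => a).
Proof. by move=> c ac m; exact: Ck_cst. Qed.

Lemma smooth_funD (W : normedModType R) U (h k : M -> W) : open U ->
  smooth_fun U h -> smooth_fun U k -> smooth_fun U (fun q => h q + k q).
Proof.
move=> oU sh sk c ac m; apply: Ck_add; last 2 first.
- exact: sh.
- exact: sk.
- exact: open_chart_image.
Qed.

Lemma smooth_fun_scale (W : normedModType R) U (s : M -> R) (h : M -> W) : open U ->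
  smooth_fun U s -> smooth_fun U h -> smooth_fun U (fun q => s q *: h q).
Proof.
move=> oU ss sh c ac m; apply: Ck_scale; last 2 first.
- exact: ss.
- exact: sh.
- exact: open_chart_image.
Qed.

Lemma smooth_fun_linear m (W : normedModType R) U (L : {linear 'rV[R]_m.+1 -> W}) h :
  open U -> smooth_fun U h -> smooth_fun U (fun q : M => L (h q)).
Proof.
move=> oU sh c ac k; apply: Ck_linear; last exact: sh.
exact: open_chart_image.
Qed.

Lemma open_dom U c : open U -> open (U `&` idfun @^-1` cdom c).
Proof. by move=> oU; apply: openI => //; exact: cdom_open. Qed.

Lemma smooth_vf_eq U X Y : open U ->
  (forall q, U q -> X q = Y q) -> smooth_vf U X -> smooth_vf U Y.
Proof.
move=> oU XY sX c ac; apply: smooth_fun_eq (sX c ac); first exact: open_dom.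
by move=> q [Uq _]; rewrite XY.
Qed.

Lemma smooth_vf_sub U U' X : U' `<=` U -> smooth_vf U X -> smooth_vf U' X.
Proof. by move=> sU sX c ac; apply: smooth_fun_sub (sX c ac); apply: setSI. Qed.

Lemma smooth_vfD U X Y : open U -> smooth_vf U X -> smooth_vf U Y ->
  smooth_vf U (fun q => X q + Y q).
Proof.
move=> oU sX sY c ac.
apply: smooth_fun_eq (smooth_funD _ (sX c ac) (sY c ac)); try exact: open_dom.
by move=> q _; rewrite linearD.
Qed.

Lemma smooth_vf_scale U (s : M -> R) X : open U -> smooth_fun U s -> smooth_vf U X ->
  smooth_vf U (fun q => s q *: X q).
Proof.
move=> oU ss sX c ac.
apply: smooth_fun_eq (smooth_fun_scale _ _ (sX c ac)); try exact: open_dom.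
  by move=> q _; rewrite linearZ.
by apply: smooth_fun_sub ss => q [].
Qed.

Lemma smooth_vfB U X Y : open U -> smooth_vf U X -> smooth_vf U Y ->
  smooth_vf U (fun q => X q - Y q).
Proof.
move=> oU sX sY; apply: smooth_vfD => //.
have H := smooth_vf_scale oU (smooth_fun_cst U (-1 : R)) sY.
by apply: smooth_vf_eq H => // q _; rewrite scaleN1r.
Qed.

Lemma smooth_vf_sum I (r : seq I) U (X : I -> M -> 'rV[R]_n.+1) : open U ->
  (forall i, smooth_vf U (X i)) -> smooth_vf U (fun q => \sum_(i <- r) X i q).
Proof.
move=> oU sX; elim: r => [|i r IH].
  apply: smooth_vf_eq (_ : smooth_vf U (fun _ => 0)) => // [q _|c ac].
    by rewrite big_nil.
  apply: smooth_fun_eq (smooth_fun_cst _ 0); first exact: open_dom.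
  by move=> q _; rewrite linear0.
by apply: smooth_vf_eq (smooth_vfD oU (sX i) IH) => // q _; rewrite big_cons.
Qed.

Lemma smooth_coord U X c k : open U -> smooth_vf U X -> atlas M c ->
  smooth_fun (U `&` cdom c) (fun q => row_coord k (coords c q (X q))).
Proof.
move=> oU sX ac; apply: (smooth_fun_linear (row_coord k)); last exact: sX c ac.
exact: open_dom.
Qed.

(** Three charts meet: the coordinates in [c'] of the frame of [c], read in [c''], are the
    differential of the transition from [c] to [c'] composed with the transition from [c''] to
    [c]. *)
Lemma smooth_frame c w : atlas M c -> smooth_vf (cdom c) (frame c w).
Proof.
move=> ac c' ac' c'' ac'' m.
set U := c'' @` _.
have oU : open U by apply: open_chart_image; apply: open_dom; exact: cdom_open.
have H : Ck m U ((fun z => 'd (c' \o cinv c) z w) \o (c \o cinv c'')).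
  apply: (@Ck_comp _ _ _ _ _ _ (c @` (cdom c `&` cdom c'))) => //.
  - by move=> _ [q [cq'' [cq cq']] <-] /=; rewrite cmapK //; exists q.
  - apply: Ck_sub (atlas_compatible ac'' ac m).
    by apply: image_subset => q [cq'' [cq _]].
  - exact: (smooth_on_differential w (atlas_compatible ac ac') m).
apply: Ck_eq H => // _ [q [cq'' [cq cq']] <-] /=.
by rewrite cmapK // coords_frame.
Qed.

End SmoothFun.

(** * Connections *)

Section Connection.
Context {R : realType} {n : nat} {M : manifold R n}.
Variable D : affine_connection M.
Implicit Types (U : set M) (X Y : M -> 'rV[R]_n.+1) (p : M).

(* Multiply by the indicator function of [U]: its derivative vanishes on [U]. *)
Lemma conn_local U X Y p v : open U -> U p -> smooth_vf U X ->
  (forall q, U q -> X q = Y q) -> D p v X = D p v Y.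
Proof.
move=> oU Up sX XY; have sY := smooth_vf_eq oU XY sX.
pose h (q : M) : R := if `[< U q >] then 1 else 0.
have h1 q : U q -> h q = 1 by move=> Uq; rewrite /h asboolT.
have nh : \forall q \near p, h q = 1 by apply: filterS (open_nbhs_nbhs (conj oU Up)).
have sh : smooth_fun U h by apply: smooth_fun_eq (smooth_fun_cst U (1 : R)) => // q Uq; rewrite h1.
have E : (fun q => h q *: X q) = (fun q => h q *: Y q).
  apply/funext => q; rewrite /h; case: asboolP => [Uq|_]; last by rewrite !scale0r.
  by rewrite XY.
have step Z : smooth_vf U Z -> D p v (fun q => h q *: Z q) = D p v Z.
  move=> sZ; rewrite (conn_leibniz D v oU Up sh sZ) (mderiv_near v nh) mderiv_cst.
  by rewrite scale0r add0r h1 // scale1r.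
by rewrite -(step X sX) E step.
Qed.

Lemma conn_zero U p v : open U -> U p -> D p v (fun _ => 0) = 0.
Proof.
move=> oU Up; have s0 : smooth_vf U (fun _ : M => 0 : 'rV[R]_n.+1).
  have := @smooth_vf_sum R n M _ [::] U (fun (_ : nat) _ => 0) oU.
  move=> H; apply: smooth_vf_eq (H _) => //; first by move=> q _; rewrite big_nil.
  move=> _ c ac; apply: smooth_fun_eq (smooth_fun_cst _ 0); first exact: open_dom.
  by move=> q _; rewrite linear0.
have := conn_add D v oU Up s0 s0; rewrite (_ : (fun _ => 0 + 0) = (fun _ : M => 0)).
  by move/eqP; rewrite addrC -subr_eq subrr eq_sym => /eqP.
by apply/funext => q; rewrite addr0.
Qed.

Lemma conn_sum I (r : seq I) U (s : I -> M -> R) (X : I -> M -> 'rV[R]_n.+1) p v :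
  open U -> U p -> (forall i, smooth_fun U (s i)) -> (forall i, smooth_vf U (X i)) ->
  D p v (fun q => \sum_(i <- r) s i q *: X i q) =
  \sum_(i <- r) (mderiv (s i) p v *: X i p + s i p *: D p v (X i)).
Proof.
move=> oU Up ss sX; elim: r => [|i r IH].
  rewrite big_nil -[RHS](conn_zero v oU Up); congr (D p v _).
  by apply/funext => q; rewrite big_nil.
rewrite big_cons -IH -(conn_leibniz D v oU Up (ss i) (sX i)).
rewrite -(conn_add D v oU Up); first by congr (D p v _); apply/funext => q; rewrite big_cons.
  exact: smooth_vf_scale.
by apply: smooth_vf_sum => // j; exact: smooth_vf_scale.
Qed.

(** The right-hand side has the shape of the definition of [cov_along]; this is the bridge between
    an axiomatic connection and its pullback. *)
Lemma conn_expansion U Y p v : open U -> U p -> smooth_vf U Y ->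
  D p v Y = mderiv (fun q => coords (chart_at M p) q (Y q)) p v
    + \sum_k Y p 0 k *: D p v (frame (chart_at M p) (delta_mx 0 k)).
Proof.
move=> oU Up sY; set c := chart_at M p.
have ac : atlas M c by exact: chart_at_atlas.
have cp : cdom c p by exact: chart_at_dom.
have oV : open (U `&` cdom c) by apply: openI => //; exact: cdom_open.
have Vp : (U `&` cdom c) p by [].
have sYV : smooth_vf (U `&` cdom c) Y by apply: smooth_vf_sub sY => q [].
have sF k : smooth_vf (U `&` cdom c) (frame c (delta_mx 0 k)).
  by apply: smooth_vf_sub (smooth_frame _ ac) => q [].
have sc k := smooth_coord k oU sY ac.
(* The frame expansion of [Y] holds only on the chart domain, so it can be substituted under [D]
   only by locality. *)
rewrite (conn_local v oV Vp sYV (fun q Vq => frame_expansion (Y q) ac (proj2 Vq))).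
rewrite (conn_sum _ v oV Vp sc sF) big_split /=; congr (_ + _); last first.
  by apply: eq_bigr => k _; rewrite coords_chart_at.
have dc : mdifferentiable (fun q => coords c q (Y q)) p.
  by apply: smooth_fun_mdifferentiable (sY c ac) _.
rewrite [RHS](frame_expansion _ ac cp) coords_chart_at; apply: eq_bigr => k _; congr (_ *: _).
by have [_ ->] := mderiv_linear (row_coord k) v dc.
Qed.

End Connection.

Section Pullback.
Context {R : realType} {m n : nat} {M : manifold R m} {Mt : manifold R n}.
Variable f : M -> Mt.
Hypothesis smooth_f : smooth_map f.
Implicit Types (p : M) (h : Mt -> R).

Lemma open_preimage (U : set Mt) : open U -> open (f @^-1` U).
Proof. by case: smooth_f => /continuousP cf _; exact: cf. Qed.

Lemma mderiv_comp (W : normedModType R) (h : Mt -> W) p v : mdifferentiable h (f p) ->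
  mdifferentiable (h \o f) p /\ mderiv (h \o f) p v = mderiv h (f p) (mdiff f p v).
Proof.
move=> dh; set c := chart_at Mt (f p).
have cf : \forall q \near p, (cdom c) (f q).
  apply: open_nbhs_nbhs; split; last exact: chart_at_dom.
  by apply: open_preimage; exact: cdom_open.
have df : mdifferentiable (c \o f) p.
  apply: smooth_fun_mdifferentiable (proj2 smooth_f c (chart_at_atlas _)) _.
  exact: chart_at_dom.
have E : ((c \o f) \o cinv (chart_at M p)) (chart_at M p p) = c (f p).
  by rewrite /= cmapK //; exact: chart_at_dom.
have [d1 d2] := diff_comp_at E df dh.
have nE : \forall y \near chart_at M p p, ((h \o cinv c) \o ((c \o f) \o cinv (chart_at M p))) y
    = ((h \o f) \o cinv (chart_at M p)) y.
  by apply: filterS (near_chart (chart_at_dom p) cf) => y cy /=; rewrite cmapK.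
have [d3 d4] := differentiable_near_eq nE d1.
by split; [exact: d3|exact (f_equal (fun L => L v) (etrans d4 d2))].
Qed.

Lemma mdiff_linear p : linear (mdiff f p).
Proof. by move=> a u v; rewrite /mdiff /mderiv linearP. Qed.
HB.instance Definition _ p := GRing.isLinear.Build R 'rV[R]_m.+1 'rV[R]_n.+1 _
  (mdiff f p) (mdiff_linear p).

End Pullback.

(** * Second derivatives on manifolds *)

(** The scalar case rests on the mean value theorem, so row values are treated coordinatewise: a
    coordinate is linear and commutes with both differentials. *)
Lemma diff_diff_sym_row (R : realType) (V : normedModType R) m
    (h : V -> 'rV[R]_m.+1) (x u v : V) :
  (\forall y \near x, differentiable h y) ->
  (forall w, differentiable (fun y => 'd h y w) x) ->
  'd (fun y => 'd h y u) x v = 'd (fun y => 'd h y v) x u.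
Proof.
move=> dh ddh; apply/rowP => k.
have dL y : differentiable (@row_coord R m k) y.
  by apply: linear_differentiable; exact: row_linear_continuous.
have dLE y : 'd (@row_coord R m k) y = @row_coord R m k :> (_ -> _).
  by apply: diff_lin; exact: row_linear_continuous.
pose hk := @row_coord R m k \o h.
have hkE : \forall y \near x, differentiable hk y /\
    forall w, 'd hk y w = row_coord k ('d h y w).
  apply: filterS dh => y dy; split; first exact: differentiable_comp.
  move=> w; have E := diff_comp dy (dL (h y)).
  by rewrite (f_equal (fun L => L w) E) /= dLE.
have step w : differentiable (fun y => 'd hk y w) x /\ forall z,
    row_coord k ('d (fun y => 'd h y w) x z) = 'd (fun y => 'd hk y w) x z.
  have nE : \forall y \near x, (@row_coord R m k \o (fun y => 'd h y w)) y = 'd hk y w.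
    by apply: filterS hkE => y [_ ->].
  have [d1 d2] := differentiable_near_eq nE (differentiable_comp (ddh w) (dL _)).
  split; first exact: d1.
  move=> z; rewrite (f_equal (fun L => L z) (etrans d2 (diff_comp (ddh w) (dL _)))) /=.
  by rewrite dLE.
have [du Eu] := step u; have [dv Ev] := step v.
have dhk : \forall y \near x, differentiable hk y by apply: filterS hkE => y [].
exact: etrans (Eu v) (etrans (diff_diff_sym dhk du dv) (esym (Ev u))).
Qed.

Section MderivSum.
Context {R : realType} {n : nat} {M : manifold R n} {W : normedModType R}.

Lemma mderiv_sum_scale I (r : seq I) (s : I -> M -> R) (h : I -> M -> W) p v :
  (forall i, mdifferentiable (s i) p) -> (forall i, mdifferentiable (h i) p) ->
  mdifferentiable (fun q => \sum_(i <- r) s i q *: h i q) p /\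
  mderiv (fun q => \sum_(i <- r) s i q *: h i q) p v =
  \sum_(i <- r) (mderiv (s i) p v *: h i p + s i p *: mderiv (h i) p v).
Proof.
move=> ds dh; elim: r => [|i r [IH1 IH2]].
  have E : (fun q => \sum_(i <- [::]) s i q *: h i q) = (fun _ : M => 0 : W).
    by apply/funext => q; rewrite big_nil.
  by rewrite E big_nil mderiv_cst; split=> //; exact: differentiable_cst.
have [d1 d2] := mderiv_scale v (ds i) (dh i).
have E : (fun q => \sum_(j <- i :: r) s j q *: h j q) =
    (fun q => s i q *: h i q + \sum_(j <- r) s j q *: h j q).
  by apply/funext => q; rewrite big_cons.
rewrite E big_cons -IH2 -d2; split; first exact: mdifferentiableD.
exact: mderivD.
Qed.

Lemma mdifferentiable_cst (a : W) p : mdifferentiable (fun _ : M => a) p.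
Proof. exact: differentiable_cst. Qed.

End MderivSum.

Section SecondDerivative.
Context {R : realType} {n : nat} {M : manifold R n}.
Implicit Types (U : set M) (X Y : M -> 'rV[R]_n.+1) (p : M).

Lemma smooth_vf_coords_mdifferentiable U Y p : open U -> U p -> smooth_vf U Y ->
  mdifferentiable (fun q => coords (chart_at M p) q (Y q)) p.
Proof.
move=> oU Up sY.
apply: smooth_fun_mdifferentiable (sY (chart_at M p) (chart_at_atlas p)) _.
by split=> //; exact: chart_at_dom.
Qed.

Lemma mderiv_coord_form (W : normedModType R) U (h : M -> W) c q v :
  smooth_fun U h -> U q -> atlas M c -> cdom c q ->
  mderiv h q v = 'd (h \o cinv c) (c q) (coords c q v).
Proof.
by move=> sh Uq ac cq; have [_ ->] := mderiv_chart v ac cq (smooth_fun_diff_chart sh ac cq Uq).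
Qed.

Lemma mdifferentiable_differential (W : normedModType R) U (h : M -> W) p w :
  open U -> U p -> smooth_fun U h ->
  differentiable (fun y => 'd (h \o cinv (chart_at M p)) y w) (chart_at M p p) /\
  mdifferentiable (fun q => 'd (h \o cinv (chart_at M p)) (chart_at M p q) w) p /\
  forall u, mderiv (fun q => 'd (h \o cinv (chart_at M p)) (chart_at M p q) w) p u
  = 'd (fun y => 'd (h \o cinv (chart_at M p)) y w) (chart_at M p p) u.
Proof.
move=> oU Up sh; set c := chart_at M p; set hc := h \o cinv c.
have cp : cdom c p by exact: chart_at_dom.
have dD : differentiable (fun y => 'd hc y w) (c p).
  apply: smooth_on_diff (smooth_on_differential w (sh c (chart_at_atlas p))) _.
  by exists p.
have nE : \forall y \near c p, 'd hc y w = ((fun q => 'd hc (c q) w) \o cinv c) y.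
  by apply: filterS (near_cimg cp) => y /cinvK /= ->.
have [d1 d2] := differentiable_near_eq nE dD.
split; first exact: dD.
by split; [exact: d1|move=> u; exact (f_equal (fun L => L u) d2)].
Qed.

(** Product rule for the differential of [h] applied to the moving vector [Y]. The first summand
    differentiates the differential with [Y] frozen at [p] and is a second derivative, symmetric in
    [Y p] and [u]; the second one differentiates the coordinates of [Y]. *)
Lemma mderiv_mderiv (W : normedModType R) U (h : M -> W) Y p u :
  open U -> U p -> smooth_fun U h -> smooth_vf U Y ->
  mdifferentiable (fun q => mderiv h q (Y q)) p /\
  mderiv (fun q => mderiv h q (Y q)) p u =
  'd (fun y => 'd (h \o cinv (chart_at M p)) y (Y p)) (chart_at M p p) u
  + mderiv h p (mderiv (fun q => coords (chart_at M p) q (Y q)) p u).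
Proof.
move=> oU Up sh sY; set c := chart_at M p; set hc := h \o cinv c.
have ac : atlas M c by exact: chart_at_atlas.
have cp : cdom c p by exact: chart_at_dom.
pose s k q := row_coord k (coords c q (Y q)).
pose e k : 'rV[R]_n.+1 := delta_mx 0 k.
pose G w q := 'd hc (c q) w.
have dY := smooth_vf_coords_mdifferentiable oU Up sY.
have ds k : mdifferentiable (s k) p.
  by have [] := mderiv_linear (row_coord k) u dY.
have dsE k : mderiv (s k) p u = row_coord k (mderiv (fun q => coords c q (Y q)) p u).
  by have [] := mderiv_linear (row_coord k) u dY.
have GP w := mdifferentiable_differential w oU Up sh.
have dG w : mdifferentiable (G w) p by have [_ []] := GP w.
(* [mderiv h q] is read in [chart_at M q], which changes with [q]; near [p] it is read again in the
   fixed chart [c], where it can be differentiated. *)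
have nE : \forall q \near p, \sum_k s k q *: G (e k) q = mderiv h q (Y q).
  apply: filterS2 (near_cdom cp) (open_nbhs_nbhs (conj oU Up)) => q cq Uq.
  by rewrite (mderiv_coord_form (Y q) sh Uq ac cq) [RHS]row_linear_sum.
have [d1 d2] := mderiv_sum_scale (index_enum _) u ds (fun k => dG (e k)).
split; first exact: mdifferentiable_near nE d1.
rewrite -(mderiv_near u nE) d2 big_split /= addrC; congr (_ + _); last first.
  rewrite /mderiv [RHS]row_linear_sum; apply: eq_bigr => k _.
  by congr (_ *: _); exact: dsE.
have [_ [_ <-]] := GP (Y p).
have -> : (fun q => 'd hc (c q) (Y p)) = fun q => \sum_k (Y p) 0 k *: G (e k) q.
  by apply/funext => q; rewrite row_linear_sum.
have [_ ->] := mderiv_sum_scale (index_enum _) u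
  (fun k => mdifferentiable_cst ((Y p) 0 k) p) (fun k => dG (e k)).
apply: eq_bigr => k _; rewrite mderiv_cst scale0r add0r; congr (_ *: _).
by rewrite /s coords_chart_at.
Qed.

(** The symmetric second-order terms of [mderiv_mderiv] cancel, and what remains is the coordinate
    formula defining the bracket. *)
Lemma mderiv_lie_bracket m U (h : M -> 'rV[R]_m.+1) X Y p :
  open U -> U p -> smooth_fun U h -> smooth_vf U X -> smooth_vf U Y ->
  mderiv (fun q => mderiv h q (Y q)) p (X p) - mderiv (fun q => mderiv h q (X q)) p (Y p)
  = mderiv h p (lie_bracket X Y p).
Proof.
move=> oU Up sh sX sY.
have [_ EY] := mderiv_mderiv (X p) oU Up sh sY.
have [_ EX] := mderiv_mderiv (Y p) oU Up sh sX.
have S : 'd (fun y => 'd (h \o cinv (chart_at M p)) y (Y p)) (chart_at M p p) (X p)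
    = 'd (fun y => 'd (h \o cinv (chart_at M p)) y (X p)) (chart_at M p p) (Y p).
  apply: diff_diff_sym_row; last first.
    by move=> w; have [] := mdifferentiable_differential w oU Up sh.
  have cp := chart_at_dom p.
  apply: filterS2 (near_cimg cp) (near_chart cp (open_nbhs_nbhs (conj oU Up))) => _ [q cq <-].
  by rewrite cmapK // => Uq; exact: smooth_fun_diff_chart sh (chart_at_atlas p) cq Uq.
have cancel (a b c d : 'rV[R]_m.+1) : a = b -> (a + c) - (b + d) = c - d.
  by move=> ->; rewrite opprD addrACA subrr add0r.
rewrite EX EY; apply: etrans (cancel _ _ _ _ S) _.
by rewrite /mderiv -linearB.
Qed.

End SecondDerivative.

(** * The pullback connection *)

Section Metric.
Context {R : realType} {n : nat} {M : manifold R n} (g : riemannian_metric M).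

Lemma metricDl q u1 u2 w : g q (u1 + u2) w = g q u1 w + g q u2 w.
Proof.
rewrite !(Defs.metric_sym g q _ w).
by have := @metric_linear _ _ _ g q w 1 u1 u2; rewrite scale1r => ->; rewrite mul1r.
Qed.

Lemma metric0l q w : g q 0 w = 0.
Proof. by apply: (addrI (g q 0 w)); rewrite -metricDl !addr0. Qed.

Lemma metricZl q a u w : g q (a *: u) w = a * g q u w.
Proof.
rewrite !(Defs.metric_sym g q _ w).
by have := @metric_linear _ _ _ g q w a u 0; rewrite addr0 => ->; rewrite (Defs.metric_sym g q w 0) metric0l addr0.
Qed.

Lemma metricDr q w u1 u2 : g q w (u1 + u2) = g q w u1 + g q w u2.
Proof. by rewrite !(Defs.metric_sym g q w) metricDl. Qed.

Lemma metricZr q w a u : g q w (a *: u) = a * g q w u.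
Proof. by rewrite !(Defs.metric_sym g q w) metricZl. Qed.

Lemma metricNl q u w : g q (- u) w = - g q u w.
Proof. by rewrite -scaleN1r metricZl mulN1r. Qed.

End Metric.

Section PullbackConnection.
Context {R : realType} {n : nat} {M : manifold R n} {Mt : manifold R n.+1}.
Variable f : M -> Mt.
Hypothesis smooth_f : smooth_map f.
Implicit Types (p : M) (V W : M -> 'rV[R]_n.+2) (Dt : affine_connection Mt).

Definition section_mdifferentiable V p : Prop :=
  mdifferentiable (fun q => coords (chart_at Mt (f p)) (f q) (V q)) p.

Lemma smooth_section_mdifferentiable V p : smooth_section f setT V ->
  section_mdifferentiable V p.
Proof.
move=> sV; apply: smooth_fun_mdifferentiable (sV _ (chart_at_atlas (f p))) _.
by split=> //; exact: chart_at_dom.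
Qed.

Lemma section_mdifferentiable_near V W p : (\forall q \near p, V q = W q) ->
  section_mdifferentiable V p -> section_mdifferentiable W p.
Proof. by move=> VW; apply: mdifferentiable_near; apply: filterS VW => q ->. Qed.

Lemma section_mdifferentiableD V W p :
  section_mdifferentiable V p -> section_mdifferentiable W p ->
  section_mdifferentiable (fun q => V q + W q) p.
Proof.
rewrite /section_mdifferentiable => dV dW.
have d := mdifferentiableD dV dW; apply: mdifferentiable_near d.
by apply: nearW => q; rewrite linearD.
Qed.

Lemma section_mdifferentiable_scale (s : M -> R) V p :
  mdifferentiable s p -> section_mdifferentiable V p ->
  section_mdifferentiable (fun q => s q *: V q) p.
Proof.
rewrite /section_mdifferentiable => ds dV.
have [d _] := mderiv_scale 0 ds dV; apply: mdifferentiable_near d.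
by apply: nearW => q; rewrite linearZ.
Qed.

Lemma near_preimage_cdom p : \forall q \near p, cdom (chart_at Mt (f p)) (f q).
Proof.
apply: open_nbhs_nbhs; split; last exact: chart_at_dom.
by apply: (open_preimage smooth_f); exact: cdom_open.
Qed.

Lemma cov_along_near Dt V W p v : (\forall q \near p, V q = W q) ->
  cov_along f Dt V p v = cov_along f Dt W p v.
Proof.
move=> VW; have VWp : V p = W p := nbhs_singleton VW.
rewrite /cov_along VWp; apply: (f_equal (fun w => w + _)).
by apply: mderiv_near; apply: filterS VW => q ->.
Qed.

Lemma cov_alongD Dt V W p v :
  section_mdifferentiable V p -> section_mdifferentiable W p ->
  cov_along f Dt (fun q => V q + W q) p v = cov_along f Dt V p v + cov_along f Dt W p v.
Proof.
move=> dV dW; rewrite /cov_along addrACA -big_split; apply: f_equal2.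
  apply: etrans _ (mderivD v dV dW).
  by apply: mderiv_near; apply: nearW => q; rewrite linearD.
by apply: eq_bigr => k _; rewrite mxE scalerDl.
Qed.

Lemma cov_along_scale Dt (s : M -> R) V p v :
  mdifferentiable s p -> section_mdifferentiable V p ->
  cov_along f Dt (fun q => s q *: V q) p v =
  mderiv s p v *: V p + s p *: cov_along f Dt V p v.
Proof.
move=> ds dV; rewrite /cov_along scalerDr addrA scaler_sumr.
apply: f_equal2; last by apply: eq_bigr => k _; rewrite mxE scalerA.
have [_ E] := mderiv_scale v ds dV; rewrite coords_chart_at in E.
by apply: etrans _ E; apply: mderiv_near; apply: nearW => q; rewrite linearZ.
Qed.

Lemma cov_along_comp Dt (U : set Mt) (W : Mt -> 'rV[R]_n.+2) p v :
  open U -> U (f p) -> smooth_vf U W ->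
  section_mdifferentiable (W \o f) p /\
  cov_along f Dt (W \o f) p v = Dt (f p) (mdiff f p v) W.
Proof.
move=> oU Up sW; have dW := smooth_vf_coords_mdifferentiable oU Up sW.
have [d1 d2] := mderiv_comp smooth_f v dW.
split; first exact: d1.
by rewrite (conn_expansion _ _ oU Up sW) /cov_along -d2.
Qed.

(** Replaces the extension of [V] to a field on [Mt]. Near [p], [V] is a combination of frame fields
    composed with [f], with coefficients differentiable at [p]. A property of germs stable under
    sums and scaling thus has to be checked only on frames, where the ambient hypotheses apply. *)
Lemma section_ind (P : (M -> 'rV[R]_n.+2) -> Prop) p :
  (forall V W, (\forall q \near p, V q = W q) -> P V -> P W) ->
  (forall V W, P V -> P W -> P (fun q => V q + W q)) ->
  (forall (s : M -> R) V, mdifferentiable s p -> P V -> P (fun q => s q *: V q)) ->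
  (forall w, P (fun q => frame (chart_at Mt (f p)) w (f q))) ->
  forall V, section_mdifferentiable V p -> P V.
Proof.
move=> Pnear PD Pscale Pframe V dV; set c := chart_at Mt (f p) in Pframe *.
pose s k q := row_coord k (coords c (f q) (V q)).
have ds k : mdifferentiable (s k) p by have [] := mderiv_linear (row_coord k) 0 dV.
(* The empty sum is obtained as the zero multiple of a frame field. *)
have P0 : P (fun _ => 0).
  apply: (Pnear _ _ _ (Pscale _ _ (mdifferentiable_cst (0 : R) p) (Pframe 0))).
  by apply: nearW => q; rewrite scale0r.
suff H r : P (fun q => \sum_(k <- r) s k q *: frame c (delta_mx 0 k) (f q)).
  apply: (Pnear _ _ _ (H (index_enum _))); apply: filterS (near_preimage_cdom p) => q cq.
  by rewrite [RHS](frame_expansion (V q) (chart_at_atlas (f p)) cq).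
elim: r => [|k r IH].
  by apply: (Pnear _ _ _ P0); apply: nearW => q; rewrite big_nil.
have := PD _ _ (Pscale _ _ (ds k) (Pframe (delta_mx 0 k))) IH.
by apply: Pnear; apply: nearW => q; rewrite big_cons.
Qed.

Lemma cov_along_endo Dt (F : endo_field Mt) V p : parallel Dt F ->
  section_mdifferentiable V p ->
  section_mdifferentiable (fun q => F (f q) (V q)) p /\
  forall v, cov_along f Dt (fun q => F (f q) (V q)) p v
  = F (f p) (cov_along f Dt V p v).
Proof.
move=> parF dV.
(* Differentiability of [V] and of [F V] joins the property proved by induction, because the sum and
   Leibniz rules for [cov_along] require it. *)
suff [] : section_mdifferentiable V p /\
  section_mdifferentiable (fun q => F (f q) (V q)) p /\
  forall v, cov_along f Dt (fun q => F (f q) (V q)) p v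
  = F (f p) (cov_along f Dt V p v) by [].
move: V dV; apply: section_ind.
- move=> V W VW [dV [dFV EV]].
  have FVW : \forall q \near p, F (f q) (V q) = F (f q) (W q) by apply: filterS VW => q ->.
  split; first exact: section_mdifferentiable_near VW dV.
  split; first exact: section_mdifferentiable_near FVW dFV.
  by move=> v; rewrite -(cov_along_near Dt v VW) -(cov_along_near Dt v FVW).
- move=> V W [dV [dFV EV]] [dW [dFW EW]].
  have E : (fun q => F (f q) (V q + W q)) = (fun q => F (f q) (V q) + F (f q) (W q)).
    by apply/funext => q; rewrite linearD.
  rewrite E; split; first exact: section_mdifferentiableD.
  split; first exact: section_mdifferentiableD.
  move=> v; rewrite (cov_alongD Dt v dFV dFW) (cov_alongD Dt v dV dW) EV EW.
  exact: esym (linearD (F (f p)) _ _).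
- move=> s V ds [dV [dFV EV]].
  have E : (fun q => F (f q) (s q *: V q)) = (fun q => s q *: F (f q) (V q)).
    by apply/funext => q; rewrite linearZ.
  rewrite E; split; first exact: section_mdifferentiable_scale.
  split; first exact: section_mdifferentiable_scale.
  move=> v; rewrite (cov_along_scale Dt v ds dFV) (cov_along_scale Dt v ds dV) EV.
  by rewrite [RHS](linearD (F (f p))) ![in RHS]linearZ.
- move=> w; set c := chart_at Mt (f p).
  have cp : cdom c (f p) by exact: chart_at_dom.
  have sF u := smooth_frame u (chart_at_atlas (f p)).
  have sFF := endo_smooth F (cdom_open c) (sF w).
  split; first by have [] := cov_along_comp Dt 0 (cdom_open c) cp (sF w).
  split; first by have [] := cov_along_comp Dt 0 (cdom_open c) cp sFF.
  move=> v; have [_ E1] := cov_along_comp Dt v (cdom_open c) cp (sF w).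
  have [_ E2] := cov_along_comp Dt v (cdom_open c) cp sFF.
  apply: etrans E2 _; rewrite -/c E1.
  (* Parallelism is stated for fields: the vector [mdiff f p v] is extended by the chart frame with
     these coordinates, whose value at [f p] is that vector. *)
  have := parF _ _ _ _ (cdom_open c) cp (sF (mdiff f p v)) (sF w).
  by rewrite /cov frame_chart_at.
Qed.

Lemma cov_along_dual gt Dt Dts V W p : dual_connection gt Dt Dts ->
  section_mdifferentiable V p -> section_mdifferentiable W p -> forall v,
  mderiv (fun q => gt (f q) (V q) (W q)) p v =
  gt (f p) (V p) (cov_along f Dts W p v) + gt (f p) (cov_along f Dt V p v) (W p).
Proof.
move=> dual dV dW.
pose Q V W := section_mdifferentiable V p /\ section_mdifferentiable W p /\
  mdifferentiable (fun q => gt (f q) (V q) (W q)) p /\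
  forall v, mderiv (fun q => gt (f q) (V q) (W q)) p v =
  gt (f p) (V p) (cov_along f Dts W p v) + gt (f p) (cov_along f Dt V p v) (W p).
suff [_ [_ []]] : Q V W by [].
(* Induction on [W], whose frame case is itself an induction on [V]. Only the case of two frame
   fields uses the ambient duality; the others are bilinearity and the Leibniz rule. *)
move: W dW; apply: section_ind; last first.
- move=> w; move: V dV; apply: section_ind; last first.
  + move=> u; set c := chart_at Mt (f p).
    have cp : cdom c (f p) by exact: chart_at_dom.
    have oc := cdom_open c.
    have sF x := smooth_frame x (chart_at_atlas (f p)).
    have sg := metric_smooth gt oc (sF u) (sF w).
    have dg := smooth_fun_mdifferentiable sg cp.
    have [d1 _] := cov_along_comp Dt 0 oc cp (sF u).
    have [d2 _] := cov_along_comp Dt 0 oc cp (sF w).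
    have [d3 _] := mderiv_comp smooth_f 0 dg.
    split; [exact: d1|split; [exact: d2|split; [exact: d3|move=> v]]].
    have [_ E] := mderiv_comp smooth_f v dg.
    have [_ E1] := cov_along_comp Dt v oc cp (sF u).
    have [_ E2] := cov_along_comp Dts v oc cp (sF w).
    apply: etrans E _.
    have := dual _ _ _ _ _ oc cp (sF u) (sF w) (sF (mdiff f p v)).
    rewrite /cov (frame_chart_at (f p) (mdiff f p v)) => E'; apply: etrans E' _.
    by apply: f_equal2; [rewrite -E2|rewrite -E1].
  + move=> s V ds [dV [dW [dg Eg]]].
    have [d1 _] := mderiv_scale 0 ds dg.
    have E : (fun q => gt (f q) (s q *: V q) (frame (chart_at Mt (f p)) w (f q))) =
        (fun q => s q *: gt (f q) (V q) (frame (chart_at Mt (f p)) w (f q))).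
      by apply/funext => q; rewrite metricZl.
    split; first exact: section_mdifferentiable_scale.
    split; first exact: dW.
    rewrite E; split; first exact: d1.
    move=> v; have [_ E2] := mderiv_scale v ds dg; apply: etrans E2 _.
    rewrite Eg (cov_along_scale Dt v ds dV).
    move: (cov_along f Dt V p v) (cov_along f Dts _ p v) => a b.
    by rewrite metricDl !metricZl /GRing.scale /=; ring.
  + move=> V V' [dV [dW [dg Eg]]] [dV' [_ [dg' Eg']]].
    have E : (fun q => gt (f q) (V q + V' q) (frame (chart_at Mt (f p)) w (f q))) =
        (fun q => gt (f q) (V q) (frame (chart_at Mt (f p)) w (f q))
                + gt (f q) (V' q) (frame (chart_at Mt (f p)) w (f q))).
      by apply/funext => q; rewrite metricDl.
    split; first exact: section_mdifferentiableD.
    split; first exact: dW.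
    rewrite E; split; first exact: mdifferentiableD.
    move=> v; apply: etrans (mderivD v dg dg') _.
    rewrite Eg Eg' (cov_alongD Dt v dV dV').
    move: (cov_along f Dt V p v) (cov_along f Dt V' p v) (cov_along f Dts _ p v) => a a' b.
    by rewrite !metricDl; ring.
  + move=> V V' VV' [dV [dW [dg Eg]]].
    have gVV' : \forall q \near p, gt (f q) (V q) (frame (chart_at Mt (f p)) w (f q))
        = gt (f q) (V' q) (frame (chart_at Mt (f p)) w (f q)) by apply: filterS VV' => q ->.
    have VVp : V p = V' p := nbhs_singleton VV'.
    split; first exact: section_mdifferentiable_near VV' dV.
    split; first exact: dW.
    split; first exact: mdifferentiable_near gVV' dg.
    move=> v; apply: etrans (esym (mderiv_near v gVV')) _.
    by rewrite Eg VVp (cov_along_near Dt v VV').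
- move=> s W ds [_ [dW [dg Eg]]].
  have [d1 _] := mderiv_scale 0 ds dg.
  have E : (fun q => gt (f q) (V q) (s q *: W q)) = (fun q => s q *: gt (f q) (V q) (W q)).
    by apply/funext => q; rewrite metricZr.
  split; first exact: dV.
  split; first exact: section_mdifferentiable_scale.
  rewrite E; split; first exact: d1.
  move=> v; have [_ E2] := mderiv_scale v ds dg; apply: etrans E2 _.
  rewrite Eg (cov_along_scale Dts v ds dW).
  move: (cov_along f Dt V p v) (cov_along f Dts W p v) => a b.
  by rewrite metricDr !metricZr /GRing.scale /=; ring.
- move=> W W' [_ [dW [dg Eg]]] [_ [dW' [dg' Eg']]].
  have E : (fun q => gt (f q) (V q) (W q + W' q)) =
      (fun q => gt (f q) (V q) (W q) + gt (f q) (V q) (W' q)).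
    by apply/funext => q; rewrite metricDr.
  split; first exact: dV.
  split; first exact: section_mdifferentiableD.
  rewrite E; split; first exact: mdifferentiableD.
  move=> v; apply: etrans (mderivD v dg dg') _.
  rewrite Eg Eg' (cov_alongD Dts v dW dW').
  move: (cov_along f Dts W p v) (cov_along f Dts W' p v) (cov_along f Dt V p v) => a a' b.
  by rewrite !metricDr; ring.
- move=> W W' WW' [_ [dW [dg Eg]]].
  have gWW' : \forall q \near p, gt (f q) (V q) (W q) = gt (f q) (V q) (W' q).
    by apply: filterS WW' => q ->.
  have WWp : W p = W' p := nbhs_singleton WW'.
  split; first exact: dV.
  split; first exact: section_mdifferentiable_near WW' dW.
  split; first exact: mdifferentiable_near gWW' dg.
  move=> v; apply: etrans (esym (mderiv_near v gWW')) _.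
  by rewrite Eg WWp (cov_along_near Dts v WW').
Qed.

End PullbackConnection.

(** * Dual and torsion-free connections *)

Section Ambient.
Context {R : realType} {n : nat} {M : manifold R n}.
Variables (g : riemannian_metric M) (D Ds : affine_connection M).
Hypothesis dual : dual_connection g D Ds.

Lemma metric_nondegenerate p u v : (forall w, g p w u = g p w v) -> u = v.
Proof.
move=> E; apply/eqP; rewrite -subr_eq0; apply: contraT => /(metric_pos g p).
have -> : g p (u - v) (u - v) = 0; last by rewrite ltxx.
by rewrite -[in X in g p _ X]scaleN1r metricDr metricZr E mulN1r subrr.
Qed.

(** By duality, [(D_X g)(Y, Z) = g(Y, Ds_X Z - D_X Z)]. Total symmetry makes the difference [Ds - D]
    symmetric in [X] and [Z], so both connections have the same torsion. *)
Lemma dual_torsion_free : statistical g D -> torsion_free Ds.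
Proof.
move=> [tD symD] U X Z p oU Up sX sZ; rewrite -(tD U X Z p oU Up sX sZ).
suff E : cov Ds X Z p + cov D Z X p = cov Ds Z X p + cov D X Z p.
  by apply/eqP; rewrite subr_eq addrAC [X in X - _]addrC -E addrK.
apply: (@metric_nondegenerate p) => w; set c := chart_at M p.
have oV : open (U `&` cdom c) by apply: openI => //; exact: cdom_open.
have Vp : (U `&` cdom c) p by split=> //; exact: chart_at_dom.
have sub W : smooth_vf U W -> smooth_vf (U `&` cdom c) W.
  by apply: smooth_vf_sub => q [].
have sY : smooth_vf (U `&` cdom c) (frame c w).
  by apply: smooth_vf_sub (smooth_frame w (chart_at_atlas p)) => q [].
have covE X' Z' : smooth_vf U X' -> smooth_vf U Z' ->
    cov_metric D g X' (frame c w) Z' p = g p w (cov Ds X' Z' p) - g p w (cov D X' Z' p).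
  move=> sX' sZ'; rewrite /cov_metric (dual oV Vp sY (sub _ sZ') (sub _ sX')).
  by rewrite frame_chart_at addrK.
have sym X' Y' Z' := symD _ X' Y' Z' _ oV Vp.
(* The exchange of the outer arguments, [(X, w, Z)] to [(Z, w, X)], is a product of three adjacent
   transpositions. *)
have [E1 _] := sym _ _ _ (sub _ sX) sY (sub _ sZ).
have [_ E2] := sym _ _ _ sY (sub _ sX) (sub _ sZ).
have [E3 _] := sym _ _ _ sY (sub _ sZ) (sub _ sX).
have := etrans E1 (etrans E2 E3); rewrite !covE // !metricDr; lra.
Qed.

(** Differentiate [g(W, Fs Y) = g(F W, Y)] along [X] by duality on both sides. Since [D F = 0], the
    terms containing [D_X W] agree, and nondegeneracy gives the rest. *)
Lemma dual_parallel F Fs : adjoint g F Fs -> parallel D F -> parallel Ds Fs.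
Proof.
move=> adj parF U X Y p oU Up sX sY; apply: (@metric_nondegenerate p) => w.
set c := chart_at M p.
have oV : open (U `&` cdom c) by apply: openI => //; exact: cdom_open.
have Vp : (U `&` cdom c) p by split=> //; exact: chart_at_dom.
have sub W : smooth_vf U W -> smooth_vf (U `&` cdom c) W.
  by apply: smooth_vf_sub => q [].
have sW : smooth_vf (U `&` cdom c) (frame c w).
  by apply: smooth_vf_sub (smooth_frame w (chart_at_atlas p)) => q [].
have sFsY := endo_smooth Fs oV (sub _ sY).
have sFW := endo_smooth F oV sW.
have E1 := dual oV Vp sW sFsY (sub _ sX).
have E2 := dual oV Vp sFW (sub _ sY) (sub _ sX).
have E : (fun q => g q (frame c w q) (Fs q (Y q))) = (fun q => g q (F q (frame c w q)) (Y q)).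
  by apply/funext => q; rewrite adj.
move: E1; rewrite E E2 (parF _ _ _ _ oV Vp (sub _ sX) sW) !adj frame_chart_at.
by move/eqP; rewrite (inj_eq (addIr _)) => /eqP.
Qed.

End Ambient.

(** * Push-forward of vector fields and torsion of the pullback connection *)

Section PushForward.
Context {R : realType} {n : nat} {M : manifold R n} {Mt : manifold R n.+1}.
Variable f : M -> Mt.
Hypothesis smooth_f : smooth_map f.
Implicit Types (p : M) (X Y : M -> 'rV[R]_n.+1) (Dt : affine_connection Mt).

Lemma near_coords_push Y p : \forall q \near p,
  coords (chart_at Mt (f p)) (f q) (push f Y q) = mderiv (chart_at Mt (f p) \o f) q (Y q).
Proof.
apply: filterS (near_preimage_cdom smooth_f p) => q cq.
have d : mdifferentiable (chart_at Mt (f p)) (f q).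
  by apply: differentiable_transition => //; exact: chart_at_atlas || exact: chart_at_dom.
by have [_ E] := mderiv_comp smooth_f (Y q) d; exact: esym E.
Qed.

Lemma smooth_chart_comp p :
  smooth_fun (f @^-1` cdom (chart_at Mt (f p))) (chart_at Mt (f p) \o f).
Proof. exact: (proj2 smooth_f _ (chart_at_atlas (f p))). Qed.

Lemma push_mdifferentiable Y p : smooth_vf setT Y -> section_mdifferentiable f (push f Y) p.
Proof.
move=> sY; have oU := open_preimage smooth_f (cdom_open (chart_at Mt (f p))).
have Up := chart_at_dom (f p).
have [d _] := mderiv_mderiv 0 oU Up (@smooth_chart_comp p) (smooth_vf_sub (@subsetT _ _) sY).
by apply: mdifferentiable_near d; apply: filterS (near_coords_push Y p) => q ->.
Qed.

(** Symmetry of the Christoffel symbols: fields with constant coordinates in one chart commute, so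
    torsion-freeness exchanges them. *)
Lemma torsion_free_frame Dt p (u w : 'rV[R]_n.+2) : torsion_free Dt ->
  \sum_k w 0 k *: Dt (f p) u (frame (chart_at Mt (f p)) (delta_mx 0 k)) =
  \sum_k u 0 k *: Dt (f p) w (frame (chart_at Mt (f p)) (delta_mx 0 k)).
Proof.
move=> tD; set c := chart_at Mt (f p).
have oc := cdom_open c; have cp : cdom c (f p) by exact: chart_at_dom.
have ac : atlas Mt c by exact: chart_at_atlas.
have sF x := smooth_frame x ac.
have const x y : mderiv (fun q => coords c q (frame c x q)) (f p) y = 0.
  rewrite -[RHS](mderiv_cst x (f p) y); apply: mderiv_near.
  apply: filterS (near_cdom cp) => q cq.
  by rewrite coords_frame // diff_transition_id.
have E x y : Dt (f p) x (frame c y) = \sum_k y 0 k *: Dt (f p) x (frame c (delta_mx 0 k)).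
  by rewrite (conn_expansion Dt x oc cp (sF y)) -/c const add0r frame_chart_at.
have := tD _ _ _ _ oc cp (sF u) (sF w).
rewrite /cov /lie_bracket -/c !const subrr !frame_chart_at !E => /eqP.
by rewrite subr_eq0 => /eqP.
Qed.

(** The Christoffel terms cancel by [torsion_free_frame]; the derivative terms are those of
    [mderiv_lie_bracket] for the coordinate expression of [f]. *)
Lemma cov_along_torsion_free Dt X Y p : torsion_free Dt ->
  smooth_vf setT X -> smooth_vf setT Y ->
  cov_along f Dt (push f Y) p (X p) - cov_along f Dt (push f X) p (Y p)
  = mdiff f p (lie_bracket X Y p).
Proof.
move=> tD sX sY; have oU := open_preimage smooth_f (cdom_open (chart_at Mt (f p))).
have Up := chart_at_dom (f p).
have sub W : smooth_vf setT W -> smooth_vf (f @^-1` cdom (chart_at Mt (f p))) W.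
  by apply: smooth_vf_sub; exact: subsetT.
have E := mderiv_lie_bracket oU Up (@smooth_chart_comp p) (sub _ sX) (sub _ sY).
have Gsym := torsion_free_frame p (mdiff f p (X p)) (mdiff f p (Y p)) tD.
apply: etrans _ E.
have cancel (a b c d : 'rV[R]_n.+2) : c = d -> (a + c) - (b + d) = a - b.
  by move=> ->; rewrite opprD addrACA subrr addr0.
apply: etrans (cancel _ _ _ _ Gsym) _; apply: f_equal2.
  exact: mderiv_near (near_coords_push Y p).
apply: (f_equal -%R); exact: mderiv_near (near_coords_push X p).
Qed.

End PushForward.

(** * Hypersurfaces *)

Section VectorFields.
Context {R : realType} {n : nat} {M : manifold R n}.

(** Bundled operations, because the Gauss and Weingarten formulas take bundled global fields. *)
Definition cov_field (D : affine_connection M) (X Y : vector_field M) : vector_field M :=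
  VectorField (conn_smooth D openT (vf_smooth X) (vf_smooth Y)).

Definition endo_field_app (A : endo_field M) (X : vector_field M) : vector_field M :=
  VectorField (endo_smooth A openT (vf_smooth X)).

Definition sub_field (X Y : vector_field M) : vector_field M :=
  VectorField (smooth_vfB openT (vf_smooth X) (vf_smooth Y)).

Definition add_field (X Y : vector_field M) : vector_field M :=
  VectorField (smooth_vfD openT (vf_smooth X) (vf_smooth Y)).

End VectorFields.

Section Hypersurface.
Context {R : realType} {n : nat} {M : manifold R n} {Mt : manifold R n.+1}.
Variables (gt : riemannian_metric Mt) (g : riemannian_metric M) (f : M -> Mt).
Variable N : M -> 'rV[R]_n.+2.
Hypothesis Hhyp : hypersurface f gt g N.
Let smooth_f : smooth_map f := hyp_smooth Hhyp.

Lemma normal_mdifferentiable p : section_mdifferentiable f N p.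
Proof. exact: smooth_section_mdifferentiable (hyp_normal_smooth Hhyp). Qed.

Lemma metric_normal_push p u : gt (f p) (N p) (mdiff f p u) = 0.
Proof. exact: hyp_normal_orthogonal Hhyp p u. Qed.

Lemma tangent_normal_inj p u u' a b :
  mdiff f p u + a *: N p = mdiff f p u' + b *: N p -> u = u'.
Proof.
move=> E; apply: (hyp_immersion Hhyp (p := p)).
have ab : a = b.
  have := f_equal (gt (f p) (N p)) E.
  by rewrite !metricDr !metricZr !metric_normal_push !(hyp_normal_unit Hhyp) !mulr1 !add0r.
by move: E; rewrite ab => /addIr.
Qed.

Lemma tangent_normal_combine p u v w a b c :
  (mdiff f p u + a *: N p) - (mdiff f p v + b *: N p) - (mdiff f p w + c *: N p)
  = mdiff f p (u - v - w) + (a - b - c) *: N p.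
Proof.
rewrite !(linearB (mdiff f p)) /=.
move: (mdiff f p _) (mdiff f p _) (mdiff f p _) (N p) => x y z t.
by apply/rowP => i; rewrite !mxE; ring.
Qed.

Section Induced.
Variables (Dt : affine_connection Mt) (D : affine_connection M) (B : endo_field M).
Hypothesis HG : gauss_formula f g Dt N D B.

Lemma induced_torsion_free (X Y : vector_field M) p : torsion_free Dt ->
  lie_bracket X Y p = cov D X Y p - cov D Y X p.
Proof.
move=> tD.
have E := cov_along_torsion_free smooth_f p tD (vf_smooth X) (vf_smooth Y).
(* The two scalars are the normal coefficients of the two sides: none for the push-forward of the
   bracket, a difference of second fundamental forms by the Gauss formula. *)
apply: (@tangent_normal_inj p _ _ 0 (g p (B p (X p)) (Y p) - g p (B p (Y p)) (X p))).
rewrite -E scale0r addr0 !HG (linearB (mdiff f p)) /=.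
move: (mdiff f p _) (mdiff f p _) (N p) => u v w.
by apply/rowP => i; rewrite !mxE; ring.
Qed.

End Induced.

Lemma induced_dual Dt Dts D Ds A As (X Y Z : vector_field M) p :
  dual_connection gt Dt Dts ->
  gauss_formula f g Dt N D As -> gauss_formula f g Dts N Ds A ->
  mderiv (fun q => g q (Y q) (Z q)) p (X p) =
  g p (Y p) (cov Ds X Z p) + g p (cov D X Y p) (Z p).
Proof.
move=> dual HG HGs.
have sY := push_mdifferentiable smooth_f p (vf_smooth Y).
have sZ := push_mdifferentiable smooth_f p (vf_smooth Z).
have -> : (fun q => g q (Y q) (Z q)) = (fun q => gt (f q) (push f Y q) (push f Z q)).
  by apply/funext => q; rewrite (hyp_isometric Hhyp).
rewrite (cov_along_dual smooth_f dual sY sZ (X p)) HG HGs.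
rewrite metricDr metricDl metricZr metricZl !(hyp_isometric Hhyp) /push.
by rewrite metric_normal_push (Defs.metric_sym gt _ _ (N p)) metric_normal_push !mulr0 !addr0.
Qed.

Definition section_curvature Dt (X Y : M -> 'rV[R]_n.+1) V p : 'rV[R]_n.+2 :=
  cov_along f Dt (fun q => cov_along f Dt V q (Y q)) p (X p)
  - cov_along f Dt (fun q => cov_along f Dt V q (X q)) p (Y p)
  - cov_along f Dt V p (lie_bracket X Y p).

(* [k] is a plain function so that the connection form [- kappa] of the dual
   connection is covered as well. *)
Definition twisted_cov (D : affine_connection M) (k : M -> 'rV[R]_n.+1 -> R)
    (A : endo_field M) (X Y : M -> 'rV[R]_n.+1) p :=
  cov D X (fun q => A q (Y q)) p - k p (X p) *: A p (Y p) - A p (cov D X Y p).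

(** * Curvature of the pullback connection: Gauss and Codazzi equations *)

Section Curvature.
Variables (Dt : affine_connection Mt) (D Ds : affine_connection M).
Variables (A B : endo_field M) (k : M -> 'rV[R]_n.+1 -> R).
Hypothesis HG : gauss_formula f g Dt N D B.
Hypothesis HW : forall (X : vector_field M) p,
  cov_along f Dt N p (X p) = - mdiff f p (A p (X p)) + k p (X p) *: N p.
Hypothesis k_smooth : forall (X : vector_field M) p, mdifferentiable (fun q => k q (X q)) p.
Hypothesis bracketE : forall (X Y : vector_field M) p,
  lie_bracket X Y p = cov D X Y p - cov D Y X p.
Hypothesis bracketEs : forall (X Y : vector_field M) p,
  lie_bracket X Y p = cov Ds X Y p - cov Ds Y X p.
Hypothesis dual : forall (X Y Z : vector_field M) p,
  mderiv (fun q => g q (Y q) (Z q)) p (X p) =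
  g p (Y p) (cov D X Z p) + g p (cov Ds X Y p) (Z p).
Implicit Types X Y Z W : vector_field M.

Lemma metric_mdifferentiable Y Z p : mdifferentiable (fun q => g q (Y q) (Z q)) p.
Proof.
exact: smooth_fun_mdifferentiable (metric_smooth g openT (vf_smooth Y) (vf_smooth Z)) I.
Qed.

Lemma cov_along_push_normal Y (s : M -> R) X p : mdifferentiable s p ->
  section_mdifferentiable f (fun q => push f Y q + s q *: N q) p /\
  cov_along f Dt (fun q => push f Y q + s q *: N q) p (X p) =
  mdiff f p (cov D X Y p - s p *: A p (X p))
  + (g p (B p (X p)) (Y p) + mderiv s p (X p) + s p * k p (X p)) *: N p.
Proof.
move=> ds; have dY := push_mdifferentiable smooth_f p (vf_smooth Y).
have dN := normal_mdifferentiable p.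
have dsN := section_mdifferentiable_scale ds dN.
split; first exact: section_mdifferentiableD.
rewrite (cov_alongD Dt (X p) dY dsN) (cov_along_scale Dt (X p) ds dN) HG HW.
rewrite (linearB (mdiff f p)) /= [in RHS]linearZ /=.
move: (mdiff f p _) (mdiff f p _) (N p) => u v w.
by apply/rowP => i; rewrite !mxE; ring.
Qed.

(** The normal part differentiates [g(B Y, Z)]. Duality splits this derivative into
    [g(Ds_X (B Y), Z)] and [g(B Y, D_X Z)], and the latter cancels against a Gauss term. This is how
    the dual connection enters the covariant derivative of [B]. *)
Lemma curvature_push X Y Z p :
  section_curvature Dt X Y (push f Z) p =
  mdiff f p (curvature D X Y Z p - g p (B p (Y p)) (Z p) *: A p (X p)
    + g p (B p (X p)) (Z p) *: A p (Y p))
  + g p (twisted_cov Ds (fun q v => - k q v) B X Y p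
         - twisted_cov Ds (fun q v => - k q v) B Y X p) (Z p) *: N p.
Proof.
pose b Y q := g q (B q (Y q)) (Z q).
have db Y' : mdifferentiable (b Y') p by exact: metric_mdifferentiable (endo_field_app B Y') Z p.
have E Y' : (fun q => cov_along f Dt (push f Z) q (Y' q)) =
    (fun q => push f (cov_field D Y' Z) q + b Y' q *: N q).
  by apply/funext => q; rewrite HG.
have [_ E1] := cov_along_push_normal (cov_field D Y Z) X (db Y).
have [_ E2] := cov_along_push_normal (cov_field D X Z) Y (db X).
have E3 := HG (sub_field (cov_field D X Y) (cov_field D Y X)) Z p.
(* The Gauss formula needs a bundled field, which [cov D X Y - cov D Y X] provides for the
   bracket. *)
have {}E3 : cov_along f Dt (push f Z) p (lie_bracket X Y p) =
    mdiff f p (cov D (lie_bracket X Y) Z p)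
    + g p (B p (lie_bracket X Y p)) (Z p) *: N p.
  by rewrite /cov bracketE.
rewrite /section_curvature (E Y) (E X) E1 E2 E3 tangent_normal_combine; apply: f_equal2.
  apply: (f_equal (mdiff f p)); rewrite /curvature /b.
  have -> : cov D X (cov_field D Y Z) p = cov D X (cov D Y Z) p by [].
  have -> : cov D Y (cov_field D X Z) p = cov D Y (cov D X Z) p by [].
  move: (cov D X _ p) (cov D Y _ p) (cov D _ Z p) (A p (X p)) (A p (Y p)) => x y z u v.
  by apply/rowP => i; rewrite !mxE; ring.
apply: (f_equal (fun a => a *: N p)).
rewrite (dual X (endo_field_app B Y) Z) (dual Y (endo_field_app B X) Z).
(* In the normal part the same bracket is expanded with [Ds], to produce the terms [B (Ds_X Y)] and
   [B (Ds_Y X)]. *)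
rewrite bracketEs /twisted_cov /b (linearB (B p)) /=.
rewrite -[D p (X p) Z]/(cov D X Z p) -[D p (Y p) Z]/(cov D Y Z p).
move: (cov Ds X _ p) (cov Ds Y _ p) (cov D X Z p) (cov D Y Z p) (B p (cov Ds X Y p))
  (B p (cov Ds Y X p)) (B p (X p)) (B p (Y p)) (Z p) (k p (X p)) (k p (Y p)).
move=> a b' c d e h x y z kx ky; rewrite !scaleNr !opprK.
rewrite !(metricDl, metricNl, metricZl).
by ring.
Qed.

Lemma curvature_normal X Y p : exists a,
  section_curvature Dt X Y N p =
  mdiff f p (- (twisted_cov D k A X Y p - twisted_cov D k A Y X p)) + a *: N p.
Proof.
(* [Y' - (Y' + A Y')] realizes [- A Y'], the tangential part of the Weingarten formula, as a bundled
   field. *)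
pose AN Y' := sub_field Y' (add_field Y' (endo_field_app A Y')).
have ANE Y' q : AN Y' q = - A q (Y' q) by rewrite /= opprD addrA subrr add0r.
have E Y' : (fun q => cov_along f Dt N q (Y' q)) =
    (fun q => push f (AN Y') q + k q (Y' q) *: N q).
  by apply/funext => q; rewrite HW /push ANE linearN.
have covAN X' Y' : cov D X' (AN Y') p = - cov D X' (fun q => A q (Y' q)) p.
  have -> : vf_fun (AN Y') = fun q => (-1 : R) *: A q (Y' q).
    by apply/funext => q; rewrite ANE scaleN1r.
  rewrite /cov (conn_leibniz _ _ openT I (smooth_fun_cst setT (-1 : R))
    (vf_smooth (endo_field_app A Y'))).
  by rewrite mderiv_cst scale0r add0r scaleN1r.
have [_ E1] := cov_along_push_normal (AN Y) X (k_smooth Y p).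
have [_ E2] := cov_along_push_normal (AN X) Y (k_smooth X p).
have E3 : cov_along f Dt N p (lie_bracket X Y p) =
    mdiff f p (- A p (lie_bracket X Y p)) + k p (lie_bracket X Y p) *: N p.
  have := HW (sub_field (cov_field D X Y) (cov_field D Y X)) p.
  by rewrite linearN bracketE.
rewrite covAN in E1; rewrite covAN in E2.
rewrite /section_curvature (E Y) (E X) E1 E2 E3 tangent_normal_combine.
eexists; apply: f_equal2; last reflexivity.
apply: (f_equal (mdiff f p)); rewrite /twisted_cov bracketE (linearB (A p)) /=.
move: (cov D X _ p) (cov D Y _ p) (A p (cov D X Y p)) (A p (cov D Y X p)) (A p (X p)) (A p (Y p)).
move=> x y z u v w.
by apply/rowP => i; rewrite !mxE; ring.
Qed.

Lemma cov_push_mdifferentiable Y Z p :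
  section_mdifferentiable f (fun q => cov_along f Dt (push f Z) q (Y q)) p.
Proof.
have -> : (fun q => cov_along f Dt (push f Z) q (Y q)) =
    (fun q => push f (cov_field D Y Z) q + g q (B q (Y q)) (Z q) *: N q).
  by apply/funext => q; rewrite HG.
have db : mdifferentiable (fun q => g q (B q (Y q)) (Z q)) p.
  exact: metric_mdifferentiable (endo_field_app B Y) Z p.
by have [] := cov_along_push_normal (cov_field D Y Z) Y db.
Qed.

Lemma cov_normal_mdifferentiable Y p :
  section_mdifferentiable f (fun q => cov_along f Dt N q (Y q)) p.
Proof.
have [d _] := cov_along_push_normal
  (sub_field Y (add_field Y (endo_field_app A Y))) Y (k_smooth Y p).
apply: section_mdifferentiable_near d; apply: nearW => q.
by rewrite HW /push /= opprD addrA subrr add0r linearN.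
Qed.

Lemma cov_push_normal_sum W (h : M -> R) q v : smooth_fun setT h ->
  cov_along f Dt (fun q => push f W q + h q *: N q) q v =
  cov_along f Dt (push f W) q v + mderiv h q v *: N q + h q *: cov_along f Dt N q v.
Proof.
move=> sh; have dh := smooth_fun_mdifferentiable sh (I : setT q).
have dN := normal_mdifferentiable q.
have dW := push_mdifferentiable smooth_f q (vf_smooth W).
rewrite (cov_alongD Dt v dW (section_mdifferentiable_scale dh dN)).
by rewrite (cov_along_scale Dt v dh dN) addrA.
Qed.

Lemma second_cov_push_normal_sum X Y W (h : M -> R) p : smooth_fun setT h ->
  section_mdifferentiable f
    (fun q => cov_along f Dt (fun q => push f W q + h q *: N q) q (Y q)) p /\
  cov_along f Dt (fun q => cov_along f Dt (fun q => push f W q + h q *: N q) q (Y q)) p (X p)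
  = cov_along f Dt (fun q => cov_along f Dt (push f W) q (Y q)) p (X p)
  + mderiv (fun q => mderiv h q (Y q)) p (X p) *: N p
  + mderiv h p (Y p) *: cov_along f Dt N p (X p)
  + mderiv h p (X p) *: cov_along f Dt N p (Y p)
  + h p *: cov_along f Dt (fun q => cov_along f Dt N q (Y q)) p (X p).
Proof.
move=> sh; have dh := smooth_fun_mdifferentiable sh (I : setT p).
have dN := normal_mdifferentiable p.
have [dhY _] := mderiv_mderiv 0 openT (I : setT p) sh (vf_smooth Y).
have d1 := cov_push_mdifferentiable Y W p.
have d2 := section_mdifferentiable_scale dhY dN.
have dNY := cov_normal_mdifferentiable Y p.
have d3 := section_mdifferentiable_scale dh dNY.
have d12 := section_mdifferentiableD d1 d2.
have -> : (fun q => cov_along f Dt (fun q => push f W q + h q *: N q) q (Y q)) =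
   (fun q => cov_along f Dt (push f W) q (Y q) + mderiv h q (Y q) *: N q
             + h q *: cov_along f Dt N q (Y q)).
  by apply/funext => q; exact: cov_push_normal_sum.
split; first exact: section_mdifferentiableD.
rewrite (cov_alongD Dt (X p) d12 d3) (cov_alongD Dt (X p) d1 d2).
by rewrite (cov_along_scale Dt (X p) dhY dN) (cov_along_scale Dt (X p) dh dNY) !addrA.
Qed.

(** The mixed terms, a derivative of [h] times a derivative of [N], are symmetric in [X] and [Y] and
    cancel. The second derivatives of [h] multiply only [N], so they enter the witness and leave the
    tangential part untouched. *)
Lemma curvature_push_normal X Y W (h : M -> R) p : smooth_fun setT h -> exists a,
  section_curvature Dt X Y (fun q => push f W q + h q *: N q) p =
  section_curvature Dt X Y (push f W) p + h p *: section_curvature Dt X Y N p + a *: N p.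
Proof.
move=> sh; have [_ E1] := second_cov_push_normal_sum X Y W p sh.
have [_ E2] := second_cov_push_normal_sum Y X W p sh.
have E3 := cov_push_normal_sum W p (lie_bracket X Y p) sh.
exists (mderiv (fun q => mderiv h q (Y q)) p (X p)
  - mderiv (fun q => mderiv h q (X q)) p (Y p) - mderiv h p (lie_bracket X Y p)).
rewrite /section_curvature E1 E2 E3.
move: (cov_along f Dt (fun q => cov_along f Dt (push f W) q (Y q)) p (X p)) => a1.
move: (cov_along f Dt (fun q => cov_along f Dt (push f W) q (X q)) p (Y p)) => a2.
move: (cov_along f Dt (fun q => cov_along f Dt N q (Y q)) p (X p)) => b1.
move: (cov_along f Dt (fun q => cov_along f Dt N q (X q)) p (Y p)) => b2.
move: (cov_along f Dt (push f W) p _) (cov_along f Dt N p _) => a3 b3.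
move: (cov_along f Dt N p (X p)) (cov_along f Dt N p (Y p)) => c1 c2.
move: (mderiv _ p (X p)) (mderiv _ p (Y p)) (mderiv h p (X p)) (mderiv h p (Y p)) => r1 r2 r3 r4.
move: (mderiv h p _) (h p) (N p) => r5 r6 v.
by apply/rowP => i; rewrite !mxE; ring.
Qed.

Lemma curvature_endo F X Y V p : parallel Dt F ->
  (forall q, section_mdifferentiable f V q) ->
  (forall Y', section_mdifferentiable f (fun q => cov_along f Dt V q (vf_fun Y' q)) p) ->
  section_curvature Dt X Y (fun q => F (f q) (V q)) p = F (f p) (section_curvature Dt X Y V p).
Proof.
move=> parF dV ddV.
have E Y' : (fun q => cov_along f Dt (fun q => F (f q) (V q)) q (vf_fun Y' q)) =
    (fun q => F (f q) (cov_along f Dt V q (Y' q))).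
  by apply/funext => q; have [_ ->] := cov_along_endo smooth_f parF (dV q).
have [_ E1] := cov_along_endo smooth_f parF (ddV Y).
have [_ E2] := cov_along_endo smooth_f parF (ddV X).
have [_ E3] := cov_along_endo smooth_f parF (dV p).
by rewrite /section_curvature (E Y) (E X) E1 E2 E3 !(linearB (F (f p))).
Qed.

(** * Comparison of tangential parts for a parallel endomorphism *)

Variables (F : endo_field Mt) (xi : M -> 'rV[R]_n.+1) (phi : endo_field M) (etas : one_form M).
Hypothesis parF : parallel Dt F.
Hypothesis Fxi : forall p, F (f p) (N p) = mdiff f p (xi p).
Hypothesis Fphi : forall X p,
  F (f p) (mdiff f p (X p)) = mdiff f p (phi p (X p)) + etas p (X p) *: N p.

Lemma structure_curvature X Y Z p :
  curvature D X Y (fun q => phi q (Z q)) p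
  + g p (B p (X p)) (phi p (Z p)) *: A p (Y p)
  - g p (B p (Y p)) (phi p (Z p)) *: A p (X p)
  - etas p (Z p) *: (twisted_cov D k A X Y p - twisted_cov D k A Y X p)
  = phi p (curvature D X Y Z p)
  - g p (B p (Y p)) (Z p) *: phi p (A p (X p))
  + g p (B p (X p)) (Z p) *: phi p (A p (Y p))
  + g p (twisted_cov Ds (fun q v => - k q v) B X Y p
         - twisted_cov Ds (fun q v => - k q v) B Y X p) (Z p) *: xi p.
Proof.
have dZ q := push_mdifferentiable smooth_f q (vf_smooth Z).
have E := curvature_endo X Y parF dZ (fun Y' => cov_push_mdifferentiable Y' Z p).
have FZ : (fun q => F (f q) (push f Z q)) =
    (fun q => push f (endo_field_app phi Z) q + etas q (Z q) *: N q).
  by apply/funext => q; rewrite Fphi.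
rewrite FZ in E.
have [a Ea] := curvature_push_normal X Y (endo_field_app phi Z) p
  (form_smooth etas openT (vf_smooth Z)).
have [b Eb] := curvature_normal X Y p.
(* [Fphi] speaks of values of global fields only. The vectors [u] for which [F (df u)] is
   [df (phi u)] modulo [N] are closed under linear combinations, and this reaches the curvature
   vector. *)
have tangentF u v c : (exists e, F (f p) (mdiff f p u) = mdiff f p (phi p u) + e *: N p) ->
    (exists e, F (f p) (mdiff f p v) = mdiff f p (phi p v) + e *: N p) ->
    exists e, F (f p) (mdiff f p (u + c *: v)) = mdiff f p (phi p (u + c *: v)) + e *: N p.
  move=> [d Ed] [e Ee]; exists (d + c * e).
  rewrite (linearD (mdiff f p)) (linearD (F (f p))) (linearD (phi p)) (linearD (mdiff f p)).
  rewrite ![in LHS]linearZ ![in RHS]linearZ /= Ed Ee.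
  move: (mdiff f p _) (mdiff f p _) (N p) => x y z.
  by apply/rowP => i; rewrite !mxE; ring.
have tangentV (W : vector_field M) : exists e,
    F (f p) (mdiff f p (W p)) = mdiff f p (phi p (W p)) + e *: N p.
  by exists (etas p (W p)); exact: Fphi.
(* The tangential part of the curvature of [push f Z], written as a sum of multiples to match
   [tangentF]. *)
pose u := curvature D X Y Z p + (- g p (B p (Y p)) (Z p)) *: A p (X p)
  + g p (B p (X p)) (Z p) *: A p (Y p).
have [e Ee] : exists e, F (f p) (mdiff f p u) = mdiff f p (phi p u) + e *: N p.
  apply: (tangentF); last exact: tangentV (endo_field_app A Y).
  apply: (tangentF); last exact: tangentV (endo_field_app A X).
  have -> : curvature D X Y Z p = cov_field D X (cov_field D Y Z) p
      + (-1) *: cov_field D Y (cov_field D X Z) p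
      + (-1) *: cov_field D (sub_field (cov_field D X Y) (cov_field D Y X)) Z p.
    by rewrite /curvature !scaleN1r [cov D (lie_bracket X Y) Z p]/cov bracketE.
  by apply: (tangentF); first apply: (tangentF); exact: tangentV.
move: E; rewrite Ea Eb !curvature_push.
have -> : curvature D X Y Z p - g p (B p (Y p)) (Z p) *: A p (X p)
    + g p (B p (X p)) (Z p) *: A p (Y p) = u by rewrite /u scaleNr.
set c := g p (twisted_cov Ds _ B X Y p - _) (Z p).
have -> : F (f p) (mdiff f p u + c *: N p) = mdiff f p (phi p u) + e *: N p + c *: mdiff f p (xi p).
  by rewrite (linearD (F (f p))) Ee [F (f p) (c *: N p)]linearZ /= Fxi.
set c' := g p (twisted_cov Ds _ B X Y p - _) (endo_field_app phi Z p).
set u' := _ + g p (B p (X p)) (endo_field_app phi Z p) *: A p (Y p).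
set s := twisted_cov D k A X Y p - _.
move=> E.
have {}E : mdiff f p (u' + etas p (Z p) *: - s) + (c' + etas p (Z p) * b + a) *: N p =
    mdiff f p (phi p u + c *: xi p) + e *: N p.
  have lin x y r : mdiff f p (x + r *: y) = mdiff f p x + r *: mdiff f p y.
    by rewrite addrC mdiff_linear addrC.
  rewrite (lin u') (lin (phi p u)).
  have -> : mdiff f p (phi p u) + c *: mdiff f p (xi p) + e *: N p
     = mdiff f p (phi p u) + e *: N p + c *: mdiff f p (xi p) by rewrite addrAC.
  rewrite -E; move: (mdiff f p _) (mdiff f p _) (N p) => x y z.
  by apply/rowP => i; rewrite !mxE; ring.
move: (tangent_normal_inj E); rewrite /u' /u scalerN /= => {}E.
apply: etrans (etrans E _).
  by apply: (f_equal (fun x => x - etas p (Z p) *: s)); rewrite addrAC.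
rewrite !(linearD (phi p)) ![phi p (_ *: _)]linearZ /=.
by rewrite scaleNr.
Qed.

End Curvature.
End Hypersurface.

Unset Implicit Arguments.

Theorem proposition5p6 (R : realType) (n : nat)
  (Mt : manifold R n.+1) (gt : riemannian_metric Mt)
  (Dt Dts : affine_connection Mt) (F Fs : endo_field Mt)
  (Hlpl : locally_product_like gt Dt F Fs)
  (Hdual : dual_connection gt Dt Dts)
  (M : manifold R n) (g : riemannian_metric M) (f : M -> Mt)
  (N : M -> 'rV[R]_n.+2)
  (Hhyp : hypersurface f gt g N)
  (Htan : tangential f F Fs N)
  (xi xis : vector_field M) (phi phis : endo_field M) (eta etas : one_form M)
  (Hxi : forall p, F (f p) (N p) = mdiff f p (xi p))
  (Hxis : forall p, Fs (f p) (N p) = mdiff f p (xis p))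
  (Hphi : forall (X : vector_field M) p,
     F (f p) (mdiff f p (X p)) =
     mdiff f p (phi p (X p)) + etas p (X p) *: N p)
  (Hphis : forall (X : vector_field M) p,
     Fs (f p) (mdiff f p (X p)) =
     mdiff f p (phis p (X p)) + eta p (X p) *: N p)
  (D Ds : affine_connection M) (A As : endo_field M) (kappa : one_form M)
  (Hgauss : gauss_formula f g Dt N D As)
  (Hweingarten : forall (X : vector_field M) p,
     cov_along f Dt N p (X p) =
     - mdiff f p (A p (X p)) + kappa p (X p) *: N p)
  (Hgauss_dual : gauss_formula f g Dts N Ds A)
  (Hweingarten_dual : forall (X : vector_field M) p,
     cov_along f Dts N p (X p) =
     - mdiff f p (As p (X p)) - kappa p (X p) *: N p)
  (X Y Z : vector_field M) (p : M) :
  curvature D X Y (fun q => phi q (Z q)) p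
  + g p (As p (X p)) (phi p (Z p)) *: A p (Y p)
  - g p (As p (Y p)) (phi p (Z p)) *: A p (X p)
  - etas p (Z p) *: (cov_shape D kappa A X Y p - cov_shape D kappa A Y X p)
  = phi p (curvature D X Y Z p)
  - g p (As p (Y p)) (Z p) *: phi p (A p (X p))
  + g p (As p (X p)) (Z p) *: phi p (A p (Y p))
  + (g p (cov_shape_dual Ds kappa As X Y p) (Z p)
     - g p (cov_shape_dual Ds kappa As Y X p) (Z p)) *: xi p
  /\
  curvature Ds X Y (fun q => phis q (Z q)) p
  + g p (A p (X p)) (phis p (Z p)) *: As p (Y p)
  - g p (A p (Y p)) (phis p (Z p)) *: As p (X p)
  - eta p (Z p) *: (cov_shape_dual Ds kappa As X Y p
                    - cov_shape_dual Ds kappa As Y X p)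
  = phis p (curvature Ds X Y Z p)
  + (g p (cov_shape D kappa A X Y p) (Z p)
     - g p (cov_shape D kappa A Y X p) (Z p)) *: xis p
  - g p (A p (Y p)) (Z p) *: phis p (As p (X p))
  + g p (A p (X p)) (Z p) *: phis p (As p (Y p)).
Proof.
have parF := lpl_parallel Hlpl.
have parFs := dual_parallel Hdual (lpl_adjoint Hlpl) parF.
have tDt := proj1 (lpl_statistical Hlpl).
have tDts := dual_torsion_free Hdual (lpl_statistical Hlpl).
have bracketD (X' Y' : vector_field M) q :=
  induced_torsion_free Hhyp Hgauss X' Y' q tDt.
have bracketDs (X' Y' : vector_field M) q :=
  induced_torsion_free Hhyp Hgauss_dual X' Y' q tDts.
have dualDs (X' Y' Z' : vector_field M) q :=
  induced_dual Hhyp X' Y' Z' q Hdual Hgauss Hgauss_dual.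
have dualD (X' Y' Z' : vector_field M) q :
    mderiv (fun r => g r (Y' r) (Z' r)) q (X' q) =
    g q (Y' q) (cov D X' Z' q) + g q (cov Ds X' Y' q) (Z' q).
  have -> : (fun r => g r (Y' r) (Z' r)) = (fun r => g r (Z' r) (Y' r)).
    by apply/funext => r; rewrite Defs.metric_sym.
  by rewrite dualDs Defs.metric_sym addrC Defs.metric_sym addrC; congr (_ + _).
have dk (X' : vector_field M) q : mdifferentiable (fun r => kappa r (X' r)) q.
  exact: smooth_fun_mdifferentiable (form_smooth kappa openT (vf_smooth X')) I.
have dkN (X' : vector_field M) q : mdifferentiable (fun r => - kappa r (X' r)) q.
  have := proj1 (mderiv_scale 0 (mdifferentiable_cst (-1 : R) q) (dk X' q)).
  by apply: mdifferentiable_near; apply: nearW => r; rewrite /= scaleN1r.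
have Hweingarten_dual' (X' : vector_field M) q : cov_along f Dts N q (X' q) =
    - mdiff f q (As q (X' q)) + (- kappa q (X' q)) *: N q.
  by rewrite Hweingarten_dual scaleNr.
have metricB u v w : g p (u - v) w = g p u w - g p v w.
  by rewrite metricDl metricNl.
have shapeDs X' Y' : twisted_cov Ds (fun q v => - kappa q v) As X' Y' p
    = cov_shape_dual Ds kappa As X' Y' p.
  by rewrite /twisted_cov scaleNr opprK.
(* For the dual structure [k] is [- kappa], and [structure_curvature] negates [k] once more in the
   term along the structure field. *)
have shapeD X' Y' : twisted_cov D (fun q v => - - kappa q v) A X' Y' p
    = cov_shape D kappa A X' Y' p.
  by rewrite /twisted_cov opprK.
split.
  have := structure_curvature (k := fun q v => kappa q v) Hhyp Hgauss Hweingarten dk bracketD bracketDs dualD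
    parF Hxi Hphi X Y Z p.
  by rewrite !shapeDs metricB.
have := structure_curvature (k := fun q v => - kappa q v) Hhyp Hgauss_dual Hweingarten_dual' dkN bracketDs bracketD
  dualDs parFs Hxis Hphis X Y Z p.
rewrite !shapeDs !shapeD metricB => ->.
apply: etrans (addrAC _ _ _) _.
by apply: (f_equal (fun x => x + _)); exact: addrAC.
Qed.
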